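(* Let $A$ be a finite alphabet and $\{F_a:a\in A\}$ a Möbius iterative system. Let $\mathcal{W}=\{W_a:a\in A\}$ be an interval almost cover such that $W_a\subseteq V_a$ for all $a\in A$, where $V_a$ is the expansion interval of $F_a^{-1}$, and let $\Sigma\subseteq A^\omega$ be a subshift compatible with $\mathcal{W}$. Then $\Sigma_{\mathcal{W}}$ is a Möbius number system for the iterative system $\{F_a:a\in A\}$. Moreover, for every $v\in A^*$, $\Phi([v]\cap\Sigma_{\mathcal{W}})=\overline{W_v}$.
   Context: $\mathbb{T}$ is the unit circle in $\mathbb{C}$. A disc preserving Möbius transformation is a map $F(z)=\frac{\alpha z+\beta}{\overline\beta z+\overline\alpha}$ with $|\alpha|^2-|\beta|^2=1$. Put $F^{\bullet}(x)=|F'(x)|$. The expansion interval of $F^{-1}$ is $\{x\in\mathbb{T}:(F^{-1})^{\bullet}(x)>1\}$ (empty if $F$ is a rotation $z\mapsto e^{i\phi}z$). Words: $A^*$ is the set of finite words over $A$ (including the empty word $\lambda$), $A^\omega$ the set of one-sided infinite words with the product topology; $w_{[0,n)}=w_0\cdots w_{n-1}$; $[v]$ is the set of $w\in A^\omega$ having $v$ as a prefix. A subshift is a closed set $\Sigma\subseteq A^\omega$ with $\sigma(\Sigma)\subseteq\Sigma$, where $\sigma(w)_i=w_{i+1}$. $\mathcal{L}(\Sigma)$ is the set of all finite words that are factors of some $w\in\Sigma$. A Möbius iterative system is a family $\{F_a:a\in A\}$ of disc preserving Möbius transformations. For $v=v_0\cdots v_{n-1}$ put $F_v=F_{v_0}\circ\cdots\circ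 F_{v_{n-1}}$ ($F_\lambda=\mathrm{id}$). A sequence $\{G_n\}$ of disc preserving Möbius transformations represents $x\in\mathbb{T}$ if $G_n\mu\to\delta_x$ weakly$^*$, where $\mu$ is the uniform probability measure on $\mathbb{T}$, $\delta_x$ is the Dirac measure at $x$ and $G\mu(E)=\mu(G^{-1}(E))$. For $w\in A^\omega$, $\Phi(w)$ is the point $x\in\mathbb{T}$ represented by $\{F_{w_{[0,n)}}\}_{n=1}^\infty$ if it exists, and is undefined otherwise. A subshift $\Sigma'\subseteq A^\omega$ is a Möbius number system for $\{F_a\}$ if $\Phi$ is defined on all of $\Sigma'$, $\Phi(\Sigma')=\mathbb{T}$ and $\Phi|_{\Sigma'}$ is continuous. An interval almost cover is a family $\mathcal{W}=\{W_a:a\in A\}$ where each $W_a$ is a union of finitely many (possibly zero) open intervals on $\mathbb{T}$ and $\bigcup_{a\in A}\overline{W_a}=\mathbb{T}$. Refined sets: $W_\lambda=\mathbb{T}$ and $W_u=W_{u_0}\cap F_{u_0}(W_{u_1})\cap\cdots\cap F_{u_{[0,n-1)}}(W_{u_{n-1}})$ for $u$ of length $n\geq1$. A nonempty subshift $\Sigma$ is compatible with $\mathcal{W}$ if for every $v\in\mathcal{L}(\Sigma)$, $\overline{W_v}=\bigcup_{a\in A,\,va\in\mathcal{L}(\Sigma)}\overline{W_{va}}$. The interval shift is $\Sigma_{\mathcal{W}}=\{w\in\Sigma:\forall n,\ W_{w_{[0,n)}}\ne\emptyset\}$ (a subshift).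
   Formalization: The last equality is stated only for words v with v in L(Σ) or W_v empty; for v not in L(Σ) with W_v nonempty it fails, since [v]∩Σ_W is empty while the closure of W_v is not. *)

(* Defs.v *)
From HB Require Import structures.
From mathcomp Require Import all_boot all_order all_algebra.
From mathcomp Require Import all_classical all_reals all_analysis.
From mathcomp Require Import measurable_realfun complex ring.

Set Implicit Arguments.
Unset Strict Implicit.
Unset Printing Implicit Defensive.

Import Order.TTheory GRing.Theory Num.Theory.
Import numFieldNormedType.Exports.

Local Open Scope classical_set_scope.
Local Open Scope ring_scope.

(* MathComp-Analysis finds the topology and the derivative of a numFieldType
   only on an abstract carrier, hence this constant in front of R[i]; its norm
   is Cx R-valued, with `<=` the partial order of R[i]. *)
Definition Cx (R : realType) : numClosedFieldType := R[i].

Definition unit_circle (R : realType) : set (Cx R) := [set z | `|z| = 1].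

(* The circle as a space of its own, with the topology induced by Cx R. *)
Definition circle (R : realType) : Type := set_type (@unit_circle R).
Arguments circle : clear implicits.

HB.instance Definition _ (R : realType) := Choice.on (circle R).
HB.instance Definition _ (R : realType) := Topological.on (circle R).

Section circle.
Context (R : realType).

Lemma cis_subproof (t : R) : (cos t +i* sin t)%C \in @unit_circle R.
Proof. by rewrite inE /unit_circle /= normc_def /= cos2Dsin2 sqrtr1. Qed.

Definition cis (t : R) : circle R :=
  exist (fun z : Cx R => z \in @unit_circle R) _ (cis_subproof t).

HB.instance Definition _ := isPointed.Build (circle R) (cis 0).
HB.instance Definition _ := Measurable.copy (circle R)
  (g_sigma_algebraType (@open (circle R))).

Lemma continuous_real_complex : continuous (fun t : R => t%:C%C : Cx R).
Proof.
move=> t; apply/cvgrPdist_lt => e e0.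
have er : e = (complex.Re e)%:C%C.
  move: e0; case: e => a b; rewrite ltcE /= => /andP[/eqP -> _] //.
have Re0 : 0 < complex.Re e by move: e0; rewrite er ltcR.
near=> s.
rewrite -rmorphB /= er normc_def /= expr0n addr0 sqrtr_sqr ltcR.
near: s.
by move/cvgrPdist_lt: (@cvg_id _ (nbhs t)); apply.
Unshelve. all: by end_near. Qed.

Lemma continuous_cis : continuous cis.
Proof.
apply/continuousP => _ [A oA <-].
rewrite -comp_preimage.
have -> : set_val \o cis =
    (fun t => (cos t)%:C%C + ('i%C : Cx R) * (sin t)%:C%C : Cx R).
  by apply/funext => t /=; rewrite [LHS]complexE.
suff : continuous (fun t => (cos t)%:C%C + ('i%C : Cx R) * (sin t)%:C%C : Cx R).
  by move/continuousP; exact.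
move=> t; apply: cvgD; last apply: cvgM; first 2 last.
- apply: (@continuous_comp _ _ _ (@sin R)); [exact: continuous_sin|].
  exact: continuous_real_complex.
- apply: (@continuous_comp _ _ _ (@cos R)); [exact: continuous_cos|].
  exact: continuous_real_complex.
- exact: cvg_cst.
Qed.

Definition cis2pi (t : measurableTypeR R) : circle R := cis (2 * pi * t).

Lemma measurable_cis2pi : measurable_fun [set: measurableTypeR R] cis2pi.
Proof.
apply: (@measurability _ _ _ _ _ _ (@open (circle R))) => // _ [A oA <-].
rewrite setTI; apply: (@open_measurable R).
suff /continuousP/(_ A oA) : continuous (cis2pi : R -> circle R) by [].
move=> t; apply: (@continuous_comp _ _ _ ( *%R (2 * pi)) cis).
  exact: mulrl_continuous.
exact: continuous_cis.
Qed.

HB.instance Definition _ :=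
  isMeasurableFun.Build _ _ _ _ cis2pi measurable_cis2pi.

(* Normalized arc length: the image of the uniform probability on [0, 1] under
   t |-> exp(2 pi i t). *)
Definition circle_unif : probability (circle R) R :=
  distribution (uniform_prob (@ltr01 R)) cis2pi.

(* The bound b <= a + 2 pi makes the parametrization injective; b = a + 2 pi
   gives the circle minus a point. *)
Definition open_arc (I : set (circle R)) : Prop :=
  exists a b : R, [/\ a < b, b <= a + 2 * pi & I = cis @` `]a, b[ ].

Definition finite_union_of_arcs (U : set (circle R)) : Prop :=
  exists (n : nat) (I : 'I_n -> set (circle R)),
    (forall i, open_arc (I i)) /\ U = \bigcup_i I i.

End circle.

Section moebius.
Context (R : realType).

Record disc_moebius := DiscMoebius {
  moeb_a : Cx R;
  moeb_b : Cx R;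
  moeb_disc : `|moeb_a| ^+ 2 - `|moeb_b| ^+ 2 = 1 }.

(* The pole, if any, lies outside the closed unit disc. *)
Definition moebius (F : disc_moebius) (z : Cx R) : Cx R :=
  (moeb_a F * z + moeb_b F) / ((moeb_b F)^* * z + (moeb_a F)^*).

Lemma moebius_num_neq0 (F : disc_moebius) (z : Cx R) :
  `|z| = 1 -> moeb_a F * z + moeb_b F != 0.
Proof.
move=> z1; apply/eqP => /eqP; rewrite addr_eq0 => /eqP e.
have := moeb_disc F; have -> : `|moeb_a F| = `|moeb_b F|.
  by rewrite -(normrN (moeb_b F)) -e normrM z1 mulr1.
by rewrite subrr => /eqP; rewrite eq_sym oner_eq0.
Qed.

Lemma moebius_denE (F : disc_moebius) (z : Cx R) : `|z| = 1 ->
  (moeb_b F)^* * z + (moeb_a F)^* = (moeb_a F * z + moeb_b F)^* * z.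
Proof.
move=> z1; have zz : z^* * z = 1 by rewrite mulrC -normCK z1 expr1n.
by rewrite rmorphD rmorphM /= mulrDl -mulrA zz mulr1 addrC.
Qed.

Lemma moebius_den_neq0 (F : disc_moebius) (z : Cx R) :
  `|z| = 1 -> (moeb_b F)^* * z + (moeb_a F)^* != 0.
Proof.
move=> z1; rewrite moebius_denE// mulf_neq0//.
  by rewrite fmorph_eq0 moebius_num_neq0.
by rewrite -normr_eq0 z1 oner_eq0.
Qed.

Lemma moebius_circle_subproof (F : disc_moebius) (x : circle R) :
  moebius F (val x) \in @unit_circle R.
Proof.
have z1 : `|val x| = 1 by have := valP x; rewrite inE.
rewrite inE /unit_circle /= /moebius normrM normfV moebius_denE//.
by rewrite normrM norm_conjC z1 mulr1 divff// normr_eq0 moebius_num_neq0.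
Qed.

Definition moebius_circle (F : disc_moebius) (x : circle R) : circle R :=
  exist (fun z : Cx R => z \in @unit_circle R) _ (moebius_circle_subproof F x).

Lemma moebius_inv_subproof (F : disc_moebius) :
  `|(moeb_a F)^*| ^+ 2 - `|- moeb_b F| ^+ 2 = 1.
Proof. by rewrite norm_conjC normrN moeb_disc. Qed.

Definition moebius_inv (F : disc_moebius) : disc_moebius :=
  DiscMoebius (moebius_inv_subproof F).

Lemma moebius_invK (F : disc_moebius) :
  cancel (moebius_circle (moebius_inv F)) (moebius_circle F).
Proof.
move=> x; apply: val_inj => /=; rewrite /moebius /=.
have z1 : `|val x| = 1 by have := valP x; rewrite inE.
have d0 := moebius_den_neq0 (moebius_inv F) z1.
move: d0; rewrite /= rmorphN /= conjCK.
have := moeb_disc F; rewrite !normCK.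
move: (moeb_a F) (moeb_b F) (Num.conj (moeb_a F)) (Num.conj (moeb_b F)).
move: (sval x) => z a b a' b' D.
set d := _ + a; set p := a' * z - b => d0.
have -> : a * (p / d) + b = z / d.
  rewrite mulrA -[X in _ + X](mulfK d0) -mulrDl; congr (_ / _).
  transitivity (z * (a * a' - b * b')); last by rewrite D mulr1.
  rewrite /p /d; ring.
have -> : b' * (p / d) + a' = d^-1.
  rewrite mulrA -[X in _ + X](mulfK d0) -mulrDl -[RHS]mul1r; congr (_ / _).
  by rewrite -D /p /d; ring.
by rewrite invrK mulfVK.
Qed.

(* The points of the circle where F^{-1} expands; moebius_inv F is F^{-1}. *)
Definition expansion_interval (F : disc_moebius) : set (circle R) :=
  [set x | 1 < `|derive1 (moebius (moebius_inv F)) (val x)|].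

(* [G n mu --> \d_x] weakly-*, tested on the continuous functions on the
   circle. *)
Definition represents (G : nat -> circle R -> circle R) (x : circle R) : Prop :=
  forall f : circle R -> R, continuous f ->
    (\int[pushforward (circle_unif R) (G n)]_y (f y)%:E)%E @[n --> \oo]
      --> (\int[\d_x]_y (f y)%:E)%E.

End moebius.

Section subshift.
Context (A : finType).

Definition omega_words : topologicalType :=
  prod_topology (fun _ : nat => discrete_topology A).

Implicit Types (w : omega_words) (v : seq A) (Sigma : set omega_words).

Definition one_sided_shift w : omega_words := fun i => w i.+1.

Definition subword w (m n : nat) : seq A := mkseq (fun i => w (m + i)%N) n.

Definition word_prefix w (n : nat) : seq A := subword w 0 n.

Definition cylinder v : set omega_words := [set w | word_prefix w (size v) = v].

Definition subshift Sigma : Prop :=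
  closed Sigma /\ one_sided_shift @` Sigma `<=` Sigma.

Definition language Sigma : set (seq A) :=
  [set v | exists w m, Sigma w /\ subword w m (size v) = v].

End subshift.

Section number_system.
Context (R : realType) (A : finType).
Variables (F : A -> disc_moebius R) (W : A -> set (circle R)).

Definition word_map (v : seq A) : circle R -> circle R :=
  foldr (fun a g => moebius_circle (F a) \o g) idfun v.

Definition Phi_defined (w : omega_words A) : Prop :=
  exists x, represents (fun n => word_map (word_prefix w n)) x.

(* Phi is partial; xget returns the junk value [point] where it is undefined. *)
Definition Phi (w : omega_words A) : circle R :=
  xget point [set x | represents (fun n => word_map (word_prefix w n)) x].

Definition moebius_number_system (Sigma : set (omega_words A)) : Prop :=
  [/\ subshift Sigma, Sigma `<=` Phi_defined, Phi @` Sigma = setT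
    & {within Sigma, continuous Phi}].

Definition interval_almost_cover : Prop :=
  (forall a, finite_union_of_arcs (W a)) /\ \bigcup_a closure (W a) = setT.

Definition refined (u : seq A) : set (circle R) :=
  \bigcap_(i : 'I_(size u))
    (word_map (take i u) @` W (tnth (in_tuple u) i)).

Definition compatible (Sigma : set (omega_words A)) : Prop :=
  Sigma !=set0 /\
  forall v, language Sigma v ->
    closure (refined v) =
    \bigcup_(a in [set a | language Sigma (rcons v a)])
      closure (refined (rcons v a)).

Definition interval_shift (Sigma : set (omega_words A)) : set (omega_words A) :=
  [set w | Sigma w /\ forall n, refined (word_prefix w n) !=set0].

End number_system.

(* Main.v *)
Require Import Defs.
From mathcomp Require Import all_boot all_order all_algebra.
From mathcomp Require Import all_classical all_reals all_analysis.
From mathcomp Require Import measurable_realfun complex ring lra.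

Set Implicit Arguments.
Unset Strict Implicit.
Unset Printing Implicit Defensive.

Import Order.TTheory GRing.Theory Num.Theory.
Import numFieldNormedType.Exports.
Import ComplexField.Normc.

Local Open Scope classical_set_scope.
Local Open Scope ring_scope.

(** Write M_n for the product F_(w_0) ... F_(w_(n-1)) and q_F(x) for the
    denominator of F^-1 at x, so that |(F^-1)'(x)| = |q_F(x)|^-2.  The refined
    sets W_(w_[0,n)) decrease, so for w in the interval shift compactness gives
    a point x in all of their closures.  The heart of the matter is that every
    such x is represented by the sequence (M_n); it is then equal to Phi(w).
    Both the equality of Phi([v]) with the closure of W_v (compatibility extends
    v letter by letter while x stays in the closure) and the continuity of Phi
    (nested compact sets that shrink to one point) follow by general topology.

    Let a_n be the leading coefficient of the matrix M_n.  As x is in the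
    closure of the points where the maps M_n^-1 expand, |q_(M_n)(x)| <= 1, hence
    |x - M_n(0)| <= 1/|a_n|, and outside a set of small diameter M_n y is close
    to M_n(0) as soon as |a_n| is large (moebius_far_close).  A set of small
    diameter has small measure, so everything reduces to |a_n| -> oo
    (expanding_limit_escape).

    If |q_(M_n)(x)| tends to 0, this follows from |q| >= |a| - |b|.  Otherwise
    the factors q_n of this nonincreasing product tend to 1, so the points
    z_n = M_n^-1 x approach the ends of the expansion intervals.  There are
    finitely many ends, so eventually the nearest ends e_n are mapped to each
    other, F_(w_n)^-1 e_n = e_(n+1).  Since F^-1 does not decrease the distance
    from z_n to e_n, yet that distance tends to 0, z_n = e_n and |q_n| = 1 from
    some n on (eventually_isometric).  From there on, in the half-plane
    coordinate with x at infinity, the letters act as real translations by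
    numbers s_n with |s_n| = |b_(w_n)|, bounded below.  A point y of W_(w_[0,n))
    close to x has a large coordinate, which each of these translations must
    bring closer to 0, because y is expanded; hence the s_n all have the same
    sign, their sums are unbounded, and so is |a_n| (parabolic_growth). *)

(** * The modulus with real values *)

Section modulus.
Context (R : realType).
Implicit Types z : Cx R.

Definition cabs z : R := normc z.

Lemma normE z : `|z| = ((cabs z)%:C)%C. Proof. by []. Qed.

Lemma cabs_ge0 z : 0 <= cabs z.
Proof. by rewrite -(@lecR R) -normE normr_ge0. Qed.

Lemma cabsM z1 z2 : cabs (z1 * z2) = cabs z1 * cabs z2.
Proof. exact: normcM. Qed.

Lemma cabsV z : cabs z^-1 = (cabs z)^-1. Proof. exact: normcV. Qed.

Lemma cabsN z : cabs (- z) = cabs z. Proof. exact: normcN. Qed.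

Lemma cabs1 : cabs 1 = 1. Proof. exact: normc1. Qed.

Lemma cabs0 : cabs 0 = 0. Proof. exact: normc0. Qed.

Lemma cabsJ z : cabs z^* = cabs z.
Proof. by apply: (@complexI R); rewrite -!normE norm_conjC. Qed.

Lemma cabsB z1 z2 : cabs (z1 - z2) = cabs (z2 - z1).
Proof. by rewrite -cabsN opprB. Qed.

Lemma cabsD z1 z2 : cabs (z1 + z2) <= cabs z1 + cabs z2.
Proof. exact: le_normcD. Qed.

Lemma cabs_eq0 z : (cabs z == 0) = (z == 0).
Proof.
apply/eqP/eqP => [/eq0_normc//|->]; exact: cabs0.
Qed.

Lemma cabs_gt0 z : (0 < cabs z) = (z != 0).
Proof. by rewrite lt_def cabs_eq0 cabs_ge0 andbT. Qed.

Lemma sqr_cabs z : ((cabs z ^+ 2)%:C)%C = z * z^* :> Cx R.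
Proof. by rewrite rmorphXn /= -normE normCK. Qed.

Lemma cabs_distD z1 z2 z3 : cabs (z1 - z3) <= cabs (z1 - z2) + cabs (z2 - z3).
Proof. by rewrite (_ : z1 - z3 = (z1 - z2) + (z2 - z3)) ?cabsD//; ring. Qed.

Lemma cabs_distB z1 z2 : cabs z1 - cabs z2 <= cabs (z1 - z2).
Proof.
by rewrite lerBlDr -[leLHS](_ : cabs (z1 - z2 + z2) = _) ?cabsD// subrK.
Qed.

End modulus.

Section circle_points.
Context (R : realType).
Implicit Types x y : circle R.

Definition cpt x : Cx R := val x.

Lemma cabs_cpt x : cabs (cpt x) = 1.
Proof.
have : `|val x| = 1 by have := valP x; rewrite inE.
by move=> h; apply: (@complexI R); rewrite -normE.
Qed.

Lemma cpt_neq0 x : cpt x != 0.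
Proof. by rewrite -cabs_gt0 cabs_cpt. Qed.

Lemma conj_cpt x : (cpt x)^* = (cpt x)^-1.
Proof.
apply: (mulfI (cpt_neq0 x)); rewrite divff ?cpt_neq0//.
by rewrite -sqr_cabs cabs_cpt expr1n.
Qed.

Lemma cpt_inj : injective (@cpt). Proof. exact: val_inj. Qed.

End circle_points.

(** * Disc preserving maps as matrices *)

Section moebius_algebra.
Context (R : realType).
Implicit Types (F G : disc_moebius R) (x y : circle R) (z : Cx R).

Lemma moeb_det F :
  moeb_a F * (moeb_a F)^* - moeb_b F * (moeb_b F)^* = 1.
Proof. by rewrite -!normCK moeb_disc. Qed.

Lemma moeb_disc_cabs F : cabs (moeb_a F) ^+ 2 = 1 + cabs (moeb_b F) ^+ 2.
Proof.
apply: (@complexI R); rewrite rmorphD/= !sqr_cabs rmorph1.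
by rewrite -[X in X + _](moeb_det F) subrK.
Qed.

Lemma moeb_comp_subproof F G :
  `|moeb_a F * moeb_a G + moeb_b F * (moeb_b G)^*| ^+ 2 -
  `|moeb_a F * moeb_b G + moeb_b F * (moeb_a G)^*| ^+ 2 = 1.
Proof.
rewrite !normCK !rmorphD !rmorphM /= !conjCK.
rewrite -[RHS](mulr1 1) -{1}(moeb_det F) -(moeb_det G); ring.
Qed.

Definition moeb_comp F G := DiscMoebius (moeb_comp_subproof F G).

Lemma moeb_id_subproof : `|1 : Cx R| ^+ 2 - `|0 : Cx R| ^+ 2 = 1.
Proof. by rewrite normr1 normr0 expr1n expr0n subr0. Qed.

Definition moeb_id := DiscMoebius moeb_id_subproof.

Lemma moebius_comp F G : moebius_circle (moeb_comp F G) =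
  moebius_circle F \o moebius_circle G.
Proof.
apply/funext => x; apply: val_inj => /=; rewrite /moebius /=.
have x1 : `|sval x| = 1 by have := valP x; rewrite inE.
have dG := moebius_den_neq0 G x1.
have dFG := moebius_den_neq0 (moeb_comp F G) x1.
have dF : (moeb_b F)^* * (moebius G (sval x)) + (moeb_a F)^* != 0.
  by apply: moebius_den_neq0; have := moebius_circle_subproof G x; rewrite inE.
move: dF dFG dG; rewrite /= /moebius !rmorphD !rmorphM /= !conjCK.
move: (moeb_a F) (moeb_b F) (moeb_a G) (moeb_b G) => a b c d.
move: a^* b^* c^* d^* (sval x) => a' b' c' d' z dF dFG dG.
have dF2 : b' * (c * z + d) + a' * (d' * z + c') != 0.
  by apply: contra dFG => /eqP e; apply/eqP; rewrite -e; ring.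
by field; rewrite dG dF2.
Qed.

Lemma moebius_id : moebius_circle moeb_id = idfun.
Proof.
apply/funext => x; apply: val_inj => /=; rewrite /moebius /=.
by rewrite rmorph0 rmorph1 mul0r add0r mul1r addr0 divr1.
Qed.

Definition pull F x : circle R := moebius_circle (moebius_inv F) x.

(** The denominator of F^-1.  Its modulus on the circle is |(F^-1)'|^(-1/2);
    it is multiplicative along orbits, and smaller than 1 where F^-1 expands. *)
Definition inv_den F z : Cx R := moeb_a F - (moeb_b F)^* * z.

Lemma pullE F x :
  cpt (pull F x) = ((moeb_a F)^* * cpt x - moeb_b F) / inv_den F (cpt x).
Proof.
by rewrite /cpt /= /moebius /= /inv_den rmorphN /= conjCK mulNr [- _ + _]addrC.
Qed.

Lemma inv_den_neq0 F x : inv_den F (cpt x) != 0.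
Proof.
have x1 : `|sval x| = 1 by have := valP x; rewrite inE.
have := moebius_den_neq0 (moebius_inv F) x1.
by rewrite /= rmorphN conjCK mulNr addrC.
Qed.

Lemma moebiusK F : cancel (moebius_circle F) (pull F).
Proof.
have -> : moebius_circle F = moebius_circle (moebius_inv (moebius_inv F)).
  apply/funext => x; apply: val_inj => /=; rewrite /moebius /=.
  by rewrite !conjCK opprK.
exact: moebius_invK.
Qed.

Lemma pullK F : cancel (pull F) (moebius_circle F).
Proof. exact: moebius_invK. Qed.

Lemma pull_comp F G x : pull (moeb_comp F G) x = pull G (pull F x).
Proof.
apply: (can_inj (moebiusK (moeb_comp F G))).
by rewrite pullK moebius_comp /= !pullK.
Qed.

Lemma pull_id x : pull moeb_id x = x.
Proof. by apply: (can_inj (moebiusK moeb_id)); rewrite pullK moebius_id. Qed.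

(** The chain rule for the square root of the derivative of the inverse map. *)
Lemma inv_denM F G x : inv_den (moeb_comp F G) (cpt x) =
  inv_den F (cpt x) * inv_den G (cpt (pull F x)).
Proof.
rewrite pullE; have := inv_den_neq0 F x.
rewrite /inv_den /= !rmorphD !rmorphM /= !conjCK => d.
by field.
Qed.

Lemma inv_den_id x : inv_den moeb_id (cpt x) = 1.
Proof. by rewrite /inv_den /= rmorph0 mul0r subr0. Qed.

(** On the circle the numerator of F^-1 is x times the conjugate of its
    denominator. *)
Lemma pull_conjE F x :
  cpt (pull F x) = cpt x * (inv_den F (cpt x))^* / inv_den F (cpt x).
Proof.
rewrite pullE; congr (_ / _).
rewrite /inv_den rmorphB rmorphM /= conjCK conj_cpt.
by have := cpt_neq0 x => x0; field.
Qed.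

(** A Moebius map multiplies a chord by the geometric mean of its derivatives
    at the two ends; being exact, this leaves no distortion to estimate. *)
Lemma pull_sub F x y : cpt (pull F x) - cpt (pull F y) =
  (cpt x - cpt y) / (inv_den F (cpt x) * inv_den F (cpt y)).
Proof.
rewrite !pullE; have := inv_den_neq0 F x; have := inv_den_neq0 F y.
rewrite /inv_den => dx dy.
rewrite -[X in X / (_ * _)]mul1r -(moeb_det F).
by field; rewrite dx dy.
Qed.

(** The translation part of F^-1 in the half-plane coordinate that sends x,
    respectively F^-1 x, to infinity. *)
Definition parab F x : Cx R := (moeb_b F)^* * cpt x / inv_den F (cpt x).

Lemma moeb_aE F x : moeb_a F = inv_den F (cpt x) * (1 + parab F x).
Proof.
have d := inv_den_neq0 F x.
by rewrite /parab mulrDr mulr1 mulrCA divff// mulr1 /inv_den subrK.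
Qed.

Lemma parab_id x : parab moeb_id x = 0.
Proof. by rewrite /parab /= rmorph0 !mul0r. Qed.

(** Maps that fix the point at infinity of a half-plane are affine, and this is
    the composition law of their translation parts. *)
Lemma parab_comp F G x : parab (moeb_comp F G) x =
  parab F x + parab G (pull F x) / (cabs (inv_den F (cpt x)) ^+ 2)%:C%C.
Proof.
have dF := inv_den_neq0 F x; have dG := inv_den_neq0 G (pull F x).
rewrite sqr_cabs {1}/parab inv_denM; have aG := moeb_aE G (pull F x).
rewrite {1}/moeb_comp /= rmorphD !rmorphM /= conjCK.
have bG : (moeb_b G)^* =
    parab G (pull F x) * inv_den G (cpt (pull F x)) / cpt (pull F x).
  rewrite /parab; have := cpt_neq0 (pull F x) => ?.
  by rewrite divfK// mulfK.
rewrite bG {1}aG.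
set pG := parab G _ in aG *; set qG := inv_den G _ in dG aG *.
rewrite pull_conjE /parab /inv_den.
have x0 := cpt_neq0 x; have det := moeb_det F.
have d' : (inv_den F (cpt x))^* != 0 by rewrite fmorph_eq0.
move: dF d' x0 det; rewrite /inv_den rmorphB rmorphM /= conjCK conj_cpt.
move: (moeb_a F) (moeb_b F) => a b; move: a^* b^* (cpt x) => a' b' z.
move=> dF d' x0 det.
have d'' : a' * z - b != 0.
  apply: contra d' => /eqP/eqP; rewrite subr_eq0 => /eqP <-.
  by rewrite mulfK// subrr.
rewrite -[pG in X in _ = X](_ : pG * (a * a' - b * b') = pG); last first.
  by rewrite det mulr1.
by field; rewrite dG dF x0 d''.
Qed.

End moebius_algebra.

(** * Expansion of the inverse map *)

Section expansion.
Context (R : realType).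
Implicit Types (F : disc_moebius R) (x y : circle R).

Lemma is_derive_affine (c d z : Cx R) :
  is_derive z 1 (fun u : Cx R => c * u + d : Cx R) c.
Proof.
have h : is_derive z (1 : Cx R) ((c *: (@id (Cx R))) + cst d) (c *: 1 + 0).
  by apply: is_deriveD; apply: is_deriveZ.
have -> : (fun u : Cx R => c * u + d : Cx R) =
    (c *: (@id (Cx R))) + cst d by [].
by apply: is_derive_eq; rewrite addr0 [_ *: _]mulr1.
Qed.

(** The quotient rule gives the determinant, 1, as numerator. *)
Lemma derive_pull F x :
  derive1 (moebius (moebius_inv F)) (cpt x) = (inv_den F (cpt x)) ^- 2.
Proof.
set N : Cx R -> Cx R := fun u => (moeb_a F)^* * u + - moeb_b F.
set D : Cx R -> Cx R := fun u => - (moeb_b F)^* * u + moeb_a F.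
have -> : moebius (moebius_inv F) = N * (fun u => (D u)^-1).
  by apply/funext => u; rewrite /moebius /= rmorphN conjCK.
have Dx : D (cpt x) = inv_den F (cpt x).
  by rewrite /D /inv_den mulNr addrC.
have D0 : D (cpt x) != 0 by rewrite Dx inv_den_neq0.
have [dN eN] := is_derive_affine ((moeb_a F)^*) (- moeb_b F) (cpt x).
have [dD eD] := is_derive_affine (- (moeb_b F)^*) (moeb_a F) (cpt x).
rewrite derive1E (deriveM dN (derivableV D0 dD)).
rewrite (deriveV D0 dD) eN eD -Dx.
transitivity (N (cpt x) * (- (D (cpt x)) ^- 2 * - (moeb_b F)^*) +
  (D (cpt x))^-1 * (moeb_a F)^*) => //.
transitivity ((moeb_a F * (moeb_a F)^* - moeb_b F * (moeb_b F)^*) /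
  D (cpt x) ^+ 2); last by rewrite moeb_det mul1r.
by move: D0; rewrite /N /D => D0; field.
Qed.

Lemma expansion_interval_lt1 F x :
  expansion_interval F x -> cabs (inv_den F (cpt x)) < 1.
Proof.
rewrite /expansion_interval /= -[val x]/(cpt x) derive_pull normfV normrX.
have q0 : 0 < cabs (inv_den F (cpt x)) by rewrite cabs_gt0 inv_den_neq0.
rewrite normE -rmorphXn -fmorphV -(rmorph1 (@real_complex R)) ltcR.
rewrite invf_gt1 ?exprn_gt0// => h.
by rewrite -(@ltr_pXn2r _ 2) ?nnegrE ?expr1n// ltW.
Qed.

End expansion.

(** * The circle as a compact metric space *)

Section circle_topology.
Context (R : realType).
Implicit Types (x y : circle R) (U S : set (circle R)).

Definition cdist x y : R := cabs (cpt x - cpt y).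

Lemma cdistC x y : cdist x y = cdist y x. Proof. exact: cabsB. Qed.

Lemma cdist_ge0 x y : 0 <= cdist x y. Proof. exact: cabs_ge0. Qed.

Lemma cdistxx x : cdist x x = 0. Proof. by rewrite /cdist subrr cabs0. Qed.

Lemma cdist_eq0 x y : cdist x y = 0 -> x = y.
Proof. by move=> /eqP; rewrite cabs_eq0 subr_eq0 => /eqP/(@cpt_inj R). Qed.

Lemma cdistD y x z : cdist x z <= cdist x y + cdist y z.
Proof. exact: cabs_distD. Qed.

Lemma pos_complexE (e : Cx R) : 0 < e -> exists2 r : R, 0 < r & e = r%:C%C.
Proof.
case: e => a b; rewrite ltcE /= => /andP[/eqP -> a0]; by exists a.
Qed.

(** Bridges the induced topology, whose balls have radii in the complex
    field, and the chordal metric, which is real. *)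
Lemma nbhs_cdistP x U : nbhs x U <->
  exists2 e : R, 0 < e & forall y, cdist x y < e -> U y.
Proof.
split.
  case=> V [[B oB <-] Bx VU].
  have : nbhs (cpt x : Cx R) B by apply: open_nbhs_nbhs; split.
  case/nbhs_ballP => e /pos_complexE[r r0 ->] he; exists r => // y xy.
  by apply: VU; apply: he; rewrite -ball_normE /ball_ /= normE ltcR.
case=> e e0 he.
pose B : set (Cx R) := ball (cpt x : Cx R) (e%:C%C : Cx R).
exists (set_val @^-1` (B^°)); split.
- by exists (B^°) => //; exact: open_interior.
- by apply: nbhsx_ballx; rewrite ltcR.
move=> y /interior_subset.
by rewrite /B -ball_normE /ball_ /= normE ltcR; exact: he.
Qed.

Lemma nbhs_cdist x (e : R) : 0 < e -> nbhs x [set y | cdist x y < e].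
Proof. by move=> e0; apply/nbhs_cdistP; exists e. Qed.

Lemma closure_cdistP S x : closure S x <->
  forall e : R, 0 < e -> exists2 y, S y & cdist x y < e.
Proof.
split=> [cS e e0|h U /nbhs_cdistP[e e0 eU]].
  by have [y [Sy xy]] := cS _ (nbhs_cdist x e0); exists y.
by have [y Sy xy] := h _ e0; exists y; split => //; exact: eU.
Qed.

Lemma continuous_cdistP (g : circle R -> circle R) :
  (forall x (e : R), 0 < e -> exists2 d : R, 0 < d &
     forall y, cdist x y < d -> cdist (g x) (g y) < e) -> continuous g.
Proof.
move=> h x U /nbhs_cdistP[e e0 eU]; apply/nbhs_cdistP.
by have [d d0 hd] := h x e e0; exists d => // y /hd /eU.
Qed.

Lemma cis_surjective x : exists2 t : R, 0 <= t <= 2 * pi & x = cis t.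
Proof.
case E : (cpt x) => [a b].
have ab : a ^+ 2 + b ^+ 2 = 1.
  have := cabs_cpt x; rewrite E /cabs /= => h.
  have : Num.sqrt (a ^+ 2 + b ^+ 2) ^+ 2 = 1 by rewrite h expr1n.
  by rewrite sqr_sqrtr// addr_ge0// sqr_ge0.
have a1 : -1 <= a <= 1 by have := sqr_ge0 b; nra.
have [b0|b0] := leP 0 b.
- exists (acos a).
    rewrite acos_ge0// (le_trans (acos_lepi a1))//.
    by have := pi_gt0 R; lra.
  apply: (@cpt_inj R); rewrite E /cpt /= acosK ?in_itv//= sin_acos//.
  by rewrite -ab addrC addKr sqrtr_sqr ger0_norm.
- exists (2 * pi - acos a).
    have := acos_ge0 a1; have := acos_lepi a1; have := pi_gt0 R; lra.
  apply: (@cpt_inj R); rewrite E /cpt /=.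
  rewrite addrC mulr_natl cosD2pi sinD2pi cosN sinN acosK ?in_itv//= sin_acos//.
  by rewrite -ab addrC addKr sqrtr_sqr ltr0_norm// opprK.
Qed.

Lemma circle_compact : compact [set: circle R].
Proof.
have -> : [set: circle R] = @cis R @` `[0, 2 * pi].
  apply/seteqP; split => // x _.
  by have [t t2 ->] := cis_surjective x; exists t => //; rewrite /= in_itv.
apply: continuous_compact; last exact: segment_compact.
exact/continuous_subspaceT/continuous_cis.
Qed.

(** A cluster point of a sequence with one term in each set. *)
Lemma decreasing_closure_nonempty (S : nat -> set (circle R)) :
  (forall m n, (m <= n)%N -> S n `<=` S m) -> (forall n, S n !=set0) ->
  exists x, forall n, closure (S n) x.
Proof.
move=> dS /choice[u hu].
have [x [_ xu]] := @circle_compact (u @ \oo) _ filterT.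
exists x => n U Ux.
apply: xu => //; exists n => // m /= nm; exact: dS (hu m).
Qed.

(** If no closure were inside U, the parts outside U would be nested nonempty
    sets, and a point in all of their closures would differ from x. *)
Lemma nested_closure_sub (S : nat -> set (circle R)) x U :
  (forall m n, (m <= n)%N -> S n `<=` S m) ->
  (forall y, (forall n, closure (S n) y) -> y = x) -> nbhs x U ->
  exists n, closure (S n) `<=` U.
Proof.
move=> dS uniq; rewrite nbhsE => -[V [oV Vx] VU]; apply: contrapT => h.
have [] := @decreasing_closure_nonempty (fun n => closure (S n) `\` V).
- by move=> m n mn y [Sy Vy]; split => //; apply: closureS Sy; exact: dS.
- move=> n; apply: contrapT => /set0P/negP; rewrite negbK => /eqP.
  rewrite setD_eq0 => SV; apply: h; exists n; exact: subset_trans VU.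
- move=> y hy.
  have yx : y = x.
    apply: uniq => n; apply: (@closed_closure _ (S n)).
    by apply: closureS (hy n) => z [].
  have : closure (~` V) y by apply: closureS (hy 0%N) => z [].
  by rewrite yx => /(_ V (open_nbhs_nbhs (conj oV Vx)))[z []].
Qed.

End circle_topology.

(** * Products, distortion, and ends of expansion intervals *)

Section products.
Context (R : realType).
Implicit Types (F G : disc_moebius R) (T : nat -> disc_moebius R).
Implicit Types x y : circle R.

Lemma disc_moebius_eq F G :
  moeb_a F = moeb_a G -> moeb_b F = moeb_b G -> F = G.
Proof.
case: F G => a b h [c d k] /= ac bd; rewrite -{}ac -{}bd in k *.
by congr DiscMoebius; exact: Prop_irrelevance.
Qed.

Lemma moeb_compA F G H :
  moeb_comp F (moeb_comp G H) = moeb_comp (moeb_comp F G) H.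
Proof.
by apply: disc_moebius_eq => /=; rewrite !rmorphD !rmorphM /= ?conjCK; ring.
Qed.

Lemma moeb_comp_id F : moeb_comp F (moeb_id R) = F.
Proof.
apply: disc_moebius_eq; rewrite /= ?rmorph0 ?rmorph1 ?mulr0 ?mulr1 ?addr0//.
by rewrite add0r.
Qed.

Fixpoint moeb_prod T n : disc_moebius R :=
  if n is n'.+1 then moeb_comp (moeb_prod T n') (T n') else moeb_id R.

Lemma moeb_prodD T m n : moeb_prod T (m + n) =
  moeb_comp (moeb_prod T m) (moeb_prod (fun i => T (m + i)%N) n).
Proof.
elim: n => [|n IH]; first by rewrite addn0 moeb_comp_id.
by rewrite addnS /= IH moeb_compA.
Qed.

Lemma cabs_b_lt_a F : cabs (moeb_b F) < cabs (moeb_a F).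
Proof.
have := moeb_disc_cabs F; have := cabs_ge0 (moeb_a F).
have := cabs_ge0 (moeb_b F); nra.
Qed.

Lemma cabs_a_ge1 F : 1 <= cabs (moeb_a F).
Proof.
have := moeb_disc_cabs F; have := cabs_ge0 (moeb_a F).
have := cabs_ge0 (moeb_b F); nra.
Qed.

(** As (|a| - |b|) (|a| + |b|) = 1, a small denominator on the circle forces a
    large matrix. *)
Lemma inv_den_ge F x :
  cabs (moeb_a F) - cabs (moeb_b F) <= cabs (inv_den F (cpt x)).
Proof.
rewrite /inv_den; apply: le_trans (cabs_distB _ _).
by rewrite cabsM cabsJ cabs_cpt mulr1.
Qed.

Lemma inv_den_gt0 F x : 0 < cabs (inv_den F (cpt x)).
Proof. by rewrite cabs_gt0 inv_den_neq0. Qed.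

Lemma inv_den_sub F x y :
  cabs (inv_den F (cpt x)) <=
  cabs (inv_den F (cpt y)) + cabs (moeb_b F) * cdist x y.
Proof.
rewrite -(cabsJ (moeb_b F)) -cabsM -(cabsN (_ * (_ - _))).
apply: le_trans (cabsD _ _).
rewrite [leRHS](_ : _ = cabs (inv_den F (cpt x)))//.
by congr cabs; rewrite /inv_den; ring.
Qed.

Lemma cdist_pull F x y : cdist (pull F x) (pull F y) =
  cdist x y / (cabs (inv_den F (cpt x)) * cabs (inv_den F (cpt y))).
Proof. by rewrite /cdist pull_sub cabsM cabsV cabsM. Qed.

Lemma cdist_pull_le F x y : cdist (pull F x) (pull F y) <=
  cdist x y / (cabs (moeb_a F) - cabs (moeb_b F)) ^+ 2.
Proof.
have d0 := cabs_b_lt_a F; rewrite -subr_gt0 in d0.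
rewrite cdist_pull ler_wpM2l ?cdist_ge0//.
rewrite lef_pV2 ?posrE ?mulr_gt0 ?exprn_gt0 ?inv_den_gt0//.
by rewrite expr2 ler_pM ?inv_den_ge// ltW.
Qed.

Lemma continuous_pull F : continuous (pull F).
Proof.
apply: continuous_cdistP => x e e0.
have d0 : 0 < (cabs (moeb_a F) - cabs (moeb_b F)) ^+ 2.
  by rewrite exprn_gt0// subr_gt0 cabs_b_lt_a.
exists (e * (cabs (moeb_a F) - cabs (moeb_b F)) ^+ 2); first exact: mulr_gt0.
move=> y xy; apply: le_lt_trans (cdist_pull_le F x y) _.
by rewrite ltr_pdivrMr.
Qed.

(** A fixed left factor shrinks the matrix at most by a bounded factor, so that an
    initial part of a product may be dropped. *)
Lemma cabs_a_comp F G :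
  (cabs (moeb_a F) - cabs (moeb_b F)) * cabs (moeb_a G) <=
  cabs (moeb_a (moeb_comp F G)).
Proof.
rewrite /=; set s := moeb_b F * _.
have -> : moeb_a F * moeb_a G + s = moeb_a F * moeb_a G - - s by rewrite opprK.
apply: le_trans (cabs_distB _ _); rewrite cabsN /s !cabsM cabsJ.
have := cabs_b_lt_a G; have := cabs_ge0 (moeb_b F); nra.
Qed.

(** A finite family of nonnegative numbers has a least positive value. *)
Lemma fin_gap (I : finType) (g : I -> R) : (forall i, 0 <= g i) ->
  exists2 e : R, 0 < e & forall i, g i < e -> g i = 0.
Proof.
move=> g0; exists (\big[Num.min/1]_(i | g i != 0) g i).
  by rewrite lt_bigmin// => i gi; rewrite lt_def gi g0.
move=> i; apply: contraTeq => gi; rewrite -leNgt.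
exact: bigmin_le_cond.
Qed.

(** With a' and b' the conjugates of a and b, the ends of the expansion interval
    are (|b|^2 + s |b|) / (a' b') for s = i and s = - i, the two roots of the
    quadratic equation for a derivative of modulus 1.  The identity says at once
    that these are the only points with derivative 1 and that a derivative near
    1 occurs only near them. *)
Lemma expansion_endpoints F : moeb_b F != 0 -> exists e : bool -> circle R,
  forall y, cdist y (e false) * cdist y (e true) =
    `|1 - cabs (inv_den F (cpt y)) ^+ 2| / (cabs (moeb_a F) * cabs (moeb_b F)).
Proof.
move=> b0.
have a0 : moeb_a F != 0 by rewrite -cabs_gt0 (lt_le_trans ltr01)// cabs_a_ge1.
have a'0 : (moeb_a F)^* != 0 by rewrite fmorph_eq0.
have b'0 : (moeb_b F)^* != 0 by rewrite fmorph_eq0.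
have det := moeb_det F.
pose t : Cx R := (cabs (moeb_b F))%:C%C.
have tt : t ^+ 2 = moeb_b F * (moeb_b F)^* by rewrite -sqr_cabs rmorphXn.
have t_conj : t^* = t.
  by rewrite /t -normE; apply: CrealP; exact: normr_real.
pose e (s : Cx R) : Cx R := (t ^+ 2 + s * t) / ((moeb_a F)^* * (moeb_b F)^*).
have e_mul (s : Cx R) : s ^+ 2 = -1 ->
    e s * e (- s) = moeb_a F * moeb_b F / ((moeb_a F)^* * (moeb_b F)^*).
  move=> s2; rewrite /e.
  transitivity ((t ^+ 2 * (t ^+ 2 - s ^+ 2)) /
    ((moeb_a F)^* * (moeb_b F)^*) ^+ 2).
    by field; rewrite ?a'0 ?b'0 ?a0 ?b0.
  rewrite s2 tt -det opprK addrC subrK.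
  by field; rewrite ?a'0 ?b'0 ?a0 ?b0.
have e_add (s : Cx R) : e s + e (- s) = 2 * moeb_b F / (moeb_a F)^*.
  transitivity (2 * t ^+ 2 / ((moeb_a F)^* * (moeb_b F)^*)).
    by rewrite /e; field; rewrite ?a'0 ?b'0 ?a0 ?b0.
  by rewrite tt; field; rewrite ?a'0 ?b'0 ?a0 ?b0.
have e_unit (s : Cx R) : s ^+ 2 = -1 -> s^* = - s -> e s \in @unit_circle R.
  move=> s2 sJ; rewrite inE /unit_circle /=.
  apply/eqP; rewrite -sqrp_eq1 ?normr_ge0// normCK; apply/eqP.
  have -> : (e s)^* =
      e (- s) * ((moeb_a F)^* * (moeb_b F)^*) / (moeb_a F * moeb_b F).
    rewrite /e fmorph_div !rmorphD !rmorphM /= !conjCK t_conj sJ.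
    by field; rewrite ?a'0 ?b'0 ?a0 ?b0.
  transitivity (e s * e (- s) *
    ((moeb_a F)^* * (moeb_b F)^* / (moeb_a F * moeb_b F))).
    by rewrite !mulrA.
  rewrite e_mul//.
  by field; rewrite ?a'0 ?b'0 ?a0 ?b0.
have i2 : 'i ^+ 2 = -1 :> Cx R := sqrCi _.
have iJ : ('i : Cx R)^* = - 'i := conjCi _.
have iN2 : (- 'i) ^+ 2 = -1 :> Cx R by rewrite sqrrN.
have iNJ : (- 'i : Cx R)^* = - - 'i by rewrite rmorphN /= iJ.
pose e1 : circle R :=
  exist (fun z : Cx R => z \in @unit_circle R) _ (e_unit _ i2 iJ).
pose e2 : circle R :=
  exist (fun z : Cx R => z \in @unit_circle R) _ (e_unit _ iN2 iNJ).
exists (fun s => if s then e2 else e1) => y; rewrite /cdist -cabsM.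
have -> : (cpt y - cpt e1) * (cpt y - cpt e2) =
    (1 - inv_den F (cpt y) * (inv_den F (cpt y))^*) * cpt y /
    ((moeb_a F)^* * (moeb_b F)^*).
  transitivity (cpt y ^+ 2 - (e 'i + e (- 'i)) * cpt y + e 'i * e (- 'i)).
    by rewrite /cpt /=; ring.
  rewrite e_add e_mul// -[in RHS]det.
  rewrite /inv_den rmorphB rmorphM /= conjCK conj_cpt.
  by have := cpt_neq0 y => y0; field; rewrite ?a'0 ?b'0 ?a0 ?b0 ?y0.
rewrite -sqr_cabs !cabsM cabs_cpt mulr1 cabsV cabsM !cabsJ; congr (_ / _).
rewrite -[1 in LHS](rmorph1 (@real_complex R)) -rmorphB.
by rewrite /cabs /= expr0n addr0 sqrtr_sqr.
Qed.

End products.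

(** * Limits of points expanded along a sequence *)

Section expanding_limits.
Context (R : realType).
Implicit Types (F G : disc_moebius R) (T : nat -> disc_moebius R).
Implicit Types x y : circle R.

(** What is retained of a point in the closure of every refined set: near x
    there are, for each n, points that the first n inverse maps all expand
    strictly.  A point x at an end of an expansion interval need not be
    expanded itself. *)
Definition expanding_limit T x : Prop := forall n (e : R), 0 < e ->
  exists2 y, cdist x y < e & forall i, (i < n)%N ->
    cabs (inv_den (T i) (cpt (pull (moeb_prod T i) y))) < 1.

Lemma expanding_limit_drop T x m : expanding_limit T x ->
  expanding_limit (fun i => T (m + i)%N) (pull (moeb_prod T m) x).
Proof.
move=> Tx n e e0.
have /nbhs_cdistP[d d0 hd] :=
  continuous_pull (nbhs_cdist (pull (moeb_prod T m) x) e0).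
have [y xy hy] := Tx (m + n)%N d d0.
exists (pull (moeb_prod T m) y); first exact: hd.
by move=> i im; rewrite -pull_comp -moeb_prodD hy// ltn_add2l.
Qed.

Lemma expanding_limit_le1 T x : expanding_limit T x ->
  forall n, cabs (inv_den (T n) (cpt (pull (moeb_prod T n) x))) <= 1.
Proof.
move=> Tx n; have {Tx} := expanding_limit_drop n Tx.
set z := pull _ x => Tz; apply: contraT; rewrite -ltNge => q1.
set q := cabs _ in q1.
have B0 := cabs_ge0 (moeb_b (T n)).
have B1 : 0 < cabs (moeb_b (T n)) + 1 by rewrite ltr_wpDl.
have e0 : 0 < (q - 1) / (cabs (moeb_b (T n)) + 1).
  by rewrite divr_gt0// subr_gt0.
have [y zy /(_ 0%N isT)] := Tz 1%N _ e0.
rewrite /= pull_id addn0 => qy.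
move: zy; rewrite ltr_pdivlMr// => zy {B1 e0}.
move: (inv_den_sub (T n) z y) (cdist_ge0 z y) zy qy B0 q1; rewrite -/q.
move: (cdist z y) (cabs (moeb_b (T n))) (cabs (inv_den _ (cpt y))) q => d b p q.
nra.
Qed.

Lemma inv_den_prod T n x : cabs (inv_den (moeb_prod T n.+1) (cpt x)) =
  cabs (inv_den (moeb_prod T n) (cpt x)) *
  cabs (inv_den (T n) (cpt (pull (moeb_prod T n) x))).
Proof. by rewrite /= inv_denM cabsM. Qed.

(** A rotation expands nothing. *)
Lemma moeb_b_neq0 T x : expanding_limit T x -> forall n, moeb_b (T n) != 0.
Proof.
move=> Tx n; have [y _ /(_ n (ltnSn n))] := Tx n.+1 1 ltr01.
apply: contraTneq => b0; rewrite -leNgt /inv_den b0 rmorph0 mul0r subr0.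
exact: cabs_a_ge1.
Qed.

Lemma cabs_Im (z : Cx R) : `|complex.Im z| <= cabs z.
Proof.
case: z => a b; rewrite /cabs /= -sqrtr_sqr ler_wsqrtr// lerDr.
exact: sqr_ge0.
Qed.

Lemma sqr_cabsE (z : Cx R) :
  cabs z ^+ 2 = complex.Re z ^+ 2 + complex.Im z ^+ 2.
Proof.
by case: z => a b; rewrite /cabs /= sqr_sqrtr// addr_ge0// sqr_ge0.
Qed.

(** With derivative 1 the affine map is a real translation; the factor i comes
    from the choice of the half-plane. *)
Lemma parab_Re0 F x :
  cabs (inv_den F (cpt x)) = 1 -> complex.Re (parab F x) = 0.
Proof.
move=> q1; have := moeb_disc_cabs F.
have bE : cabs (moeb_b F) = cabs (parab F x).
  by rewrite /parab !cabsM cabsV q1 invr1 mulr1 cabs_cpt mulr1 cabsJ.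
rewrite bE (moeb_aE F x) cabsM q1 mul1r !sqr_cabsE.
by case: (parab F x) => a b /=; rewrite add0r; lra.
Qed.

Lemma cabs_parab F x :
  cabs (inv_den F (cpt x)) = 1 -> cabs (parab F x) = cabs (moeb_b F).
Proof.
by move=> q1; rewrite /parab !cabsM cabsV q1 invr1 mulr1 cabs_cpt mulr1 cabsJ.
Qed.

(** 1 - y / x is the inverse of the half-plane coordinate of y with x at
    infinity. *)
Lemma inv_den_parab F x y : inv_den F (cpt y) =
  inv_den F (cpt x) * (1 + parab F x * (1 - cpt y / cpt x)).
Proof.
have d := inv_den_neq0 F x; have x0 := cpt_neq0 x.
move: d; rewrite /parab /inv_den => d; by field; rewrite ?x0 ?d.
Qed.

(** The map y |-> 1 / (1 - y / x) sends the circle to the boundary line of a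
    half-plane, and x to infinity. *)
Lemma chord_inv_Re x y : x != y ->
  complex.Re ((1 - cpt y / cpt x)^-1) = 2^-1.
Proof.
move=> xy; set r := 1 - _.
have r0 : r != 0.
  rewrite /r subr_eq0; apply: contra xy => /eqP e; apply/eqP/(@cpt_inj R).
  by rewrite -(divfK (cpt_neq0 x) (cpt y)) -e mul1r.
have rJ0 : r^* != 0 by rewrite fmorph_eq0.
have h : r^-1 + (r^-1)^* = 1.
  have e : r + r^* = r * r^*.
    rewrite /r rmorphB rmorph1 rmorphM /= fmorphV /= !conj_cpt.
    by have x0 := cpt_neq0 x; have y0 := cpt_neq0 y; field; rewrite ?x0 ?y0.
  rewrite fmorphV -[X in X + _]mul1r -[X in _ + X]mul1r addf_div// !mul1r.
  by rewrite addrC e divff// mulf_neq0.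
have : complex.Re (r^-1 + (r^-1)^*) = 1 by rewrite h.
by case: r^-1 => a b /=; lra.
Qed.

Section parabolic.
Variables (T : nat -> disc_moebius R) (x : circle R).
Hypothesis Tx : expanding_limit T x.
Hypothesis q1 : forall n,
  cabs (inv_den (T n) (cpt (pull (moeb_prod T n) x))) = 1.

Let S n := complex.Im (parab (moeb_prod T n) x).
Let s n := complex.Im (parab (T n) (pull (moeb_prod T n) x)).

Let Q1 n : cabs (inv_den (moeb_prod T n) (cpt x)) = 1.
Proof.
elim: n => [|n IH]; last by rewrite inv_den_prod IH q1 mulr1.
by rewrite inv_den_id cabs1.
Qed.

Let S0 : S 0 = 0. Proof. by rewrite /S /= parab_id. Qed.

Let SS n : S n.+1 = S n + s n.
Proof.
rewrite /S /s /= parab_comp Q1 expr1n.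
set u := parab (moeb_prod T n) x; set v := parab (T n) _.
have -> : v / 1%:C%C = v by rewrite rmorph1 divr1.
by case: u v => [? ?] [].
Qed.

Let sE n : `|s n| = cabs (moeb_b (T n)).
Proof.
rewrite -(cabs_parab (q1 n)).
have := parab_Re0 (q1 n); rewrite /s; case: parab => a b /= ->.
by rewrite /cabs /= expr0n add0r sqrtr_sqr.
Qed.

(** Take y so close to x that its coordinate v exceeds all the partial sums S_i
    with i <= n + 1.  Expansion of y by each letter says that |v + S_i|
    decreases with i, so that each s_i with i <= n has the sign of - v. *)
Let same_sign n : 0 < s 0 * s n.
Proof.
have [B hB] : exists B : R, forall i, (i <= n.+1)%N -> `|S i| <= B.
  exists (\sum_(i < n.+2) `|S i|) => i i_n.
  have i_n' : (i < n.+2)%N by [].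
  rewrite (bigD1 (Ordinal i_n'))//= lerDl; exact: sumr_ge0.
have B0 : 0 <= B by apply: le_trans (hB 0%N isT); exact: normr_ge0.
have B1 : 0 < (B + 1)^-1 by rewrite invr_gt0 ltr_wpDl.
have [y xy hy] := Tx n.+1 B1.
have yx : x != y.
  apply: contraTneq (hy 0%N isT) => <-.
  by rewrite q1 ltxx.
set r := 1 - cpt y / cpt x.
have rE : cabs r = cdist x y.
  rewrite /r -[X in X - _](divff (cpt_neq0 x)) -mulrBl cabsM cabsV cabs_cpt.
  by rewrite invr1 mulr1.
have r0 : r != 0.
  rewrite -cabs_gt0 rE lt_def cdist_ge0 andbT.
  by apply: contra yx => /eqP/cdist_eq0 ->.
set v := complex.Im r^-1.
have vB : B < `|v|.
  have : cabs r^-1 ^+ 2 = 2^-1 ^+ 2 + `|v| ^+ 2.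
    by rewrite sqr_cabsE chord_inv_Re// real_normK// num_real.
  have : B + 1 < cabs r^-1.
    by rewrite cabsV rE -[ltLHS]invrK ltf_pV2 ?posrE// -rE cabs_gt0.
  have := normr_ge0 v; move: `|v| (cabs r^-1) => nv c nv0 Bc c2.
  rewrite ltNge; apply/negP => nvB.
  have : nv ^+ 2 <= B ^+ 2 by rewrite ler_pXn2r ?nnegrE.
  have : (B + 1) ^+ 2 < c ^+ 2 by rewrite ltr_pXn2r ?nnegrE//; lra.
  rewrite c2; lra.
have qE i : cabs (inv_den (moeb_prod T i) (cpt y)) ^+ 2 =
    (4^-1 + (v + S i) ^+ 2) * cabs r ^+ 2.
  rewrite (inv_den_parab _ x) -/r cabsM Q1 mul1r.
  have -> : 1 + parab (moeb_prod T i) x * r =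
      (r^-1 + parab (moeb_prod T i) x) * r by rewrite mulrDl mulVf.
  rewrite cabsM exprMn; congr (_ * _); rewrite sqr_cabsE.
  have := chord_inv_Re yx; have := parab_Re0 (Q1 i).
  rewrite -/r /v /S; case: r^-1 => a b; case: parab => c d /= -> ->.
  by rewrite addr0; congr (_ + _); lra.
have lt_step i : (i <= n)%N -> (v + S i.+1) ^+ 2 < (v + S i) ^+ 2.
  move=> i_n; rewrite -(ltrD2l 4^-1) -(@ltr_pM2r _ (cabs r ^+ 2)); last first.
    by rewrite exprn_gt0// cabs_gt0.
  rewrite -!qE inv_den_prod ltr_pXn2r ?nnegrE ?mulr_ge0 ?cabs_ge0//.
  by rewrite gtr_pMr ?inv_den_gt0// hy.
have sv i : (i <= n)%N -> s i * v < 0.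
  move=> i_n; have := lt_step i i_n; rewrite SS.
  have := hB i (leqW i_n); have := hB i.+1 i_n; rewrite SS.
  rewrite !ler_norml => /andP[? ?] /andP[? ?].
  have [v0|v0] := leP 0 v.
    by move: vB; rewrite ger0_norm// => ? ?; nra.
  by move: vB; rewrite ltr0_norm// => ? ?; nra.
have := sv 0%N isT; have := sv n (leqnn n).
move: (s 0) (s n) => a b; nra.
Qed.

(** Steps of the same sign and of size at least m add up to n m, and
    |a| = |1 + i S_n| bounds that sum. *)
Lemma parabolic_growth (m : R) : (forall n, m <= cabs (moeb_b (T n))) ->
  forall n, n%:R * m <= cabs (moeb_a (moeb_prod T n)).
Proof.
move=> hm n.
have : n%:R * m <= Num.sg (s 0) * S n.
  elim: n => [|n IH]; first by rewrite mul0r S0 mulr0.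
  rewrite SS mulrDr -natr1 mulrDl mul1r lerD//.
  suff -> : Num.sg (s 0) * s n = `|s n| by rewrite sE.
  have := same_sign n.
  have [->|s0|s0] := sgrP (s 0); first by rewrite mul0r ltxx.
    by rewrite pmulr_rgt0// mul1r => /gtr0_norm ->.
  by rewrite nmulr_rgt0// mulN1r => /ltr0_norm ->.
move=> /le_trans; apply.
rewrite (moeb_aE _ x) cabsM Q1 mul1r; apply: le_trans (cabs_Im _).
rewrite (_ : complex.Im (1 + _) = S n); last first.
  by rewrite /S; case: parab => a b /=; rewrite add0r.
apply: le_trans (ler_norm _) _; rewrite normrM.
rewrite ler_piMl// normr_sg; by case: eqP.
Qed.

End parabolic.

End expanding_limits.

(** * Escape of the products to the boundary *)

Section escape_to_boundary.
Context (R : realType).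
Implicit Types (x y : circle R).

Lemma min_lt_of_mul_lt (d p q : R) : 0 <= p -> 0 <= q -> 0 < d ->
  p * q < d ^+ 2 -> Num.min p q < d.
Proof.
move=> p0 q0 d0 h; rewrite gt_min; apply: contraTT h.
by rewrite negb_or -!leNgt => /andP[dp dq]; rewrite expr2 ler_pM// ltW.
Qed.

Lemma inv_den_small (G : disc_moebius R) x (K : R) : 0 < K ->
  cabs (inv_den G (cpt x)) < (2 * K)^-1 -> K <= cabs (moeb_a G).
Proof.
move=> K0 qK; have := inv_den_ge G x; have := moeb_disc_cabs G.
have := cabs_b_lt_a G; have := cabs_ge0 (moeb_b G).
move: qK; rewrite -[ltRHS]mul1r ltr_pdivlMr ?mulr_gt0//.
move: (cabs (moeb_a G)) (cabs (moeb_b G)) (cabs _) => a b q.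
move=> qK b0 ba disc abq; rewrite leNgt; apply/negP => aK.
have : (a - b) * (a + b) = 1 by rewrite -subr_sqr disc addrK.
have : (a - b) * (a + b) <= (a - b) * (2 * K) by rewrite ler_wpM2l; lra.
have : (a - b) * (2 * K) <= q * (2 * K) by rewrite ler_wpM2r; lra.
lra.
Qed.

Variables (A : finType) (F : A -> disc_moebius R) (w : nat -> A).
Let T n := F (w n).

Section non_contracting.
Variables (x : circle R) (c : R).
Hypotheses (Tx : expanding_limit T x) (c0 : 0 < c).
Hypothesis Qc : forall n, c <= cabs (inv_den (moeb_prod T n) (cpt x)).

Let z n := pull (moeb_prod T n) x.
Let q n := cabs (inv_den (T n) (cpt (z n))).
Let Q n := cabs (inv_den (moeb_prod T n) (cpt x)).

Let q_le1 n : q n <= 1. Proof. exact: expanding_limit_le1. Qed.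

Let QS n : Q n.+1 = Q n * q n. Proof. exact: inv_den_prod. Qed.

Let Q_le1 n : Q n <= 1.
Proof.
elim: n => [|n IH]; first by rewrite /Q inv_den_id cabs1.
by rewrite QS mulr_ile1 ?cabs_ge0.
Qed.

Let q_ge n : c <= q n.
Proof.
apply: le_trans (Qc n.+1) _.
by rewrite -/(Q _) QS ler_piMl ?cabs_ge0 ?Q_le1.
Qed.

Let zS n : z n.+1 = pull (T n) (z n). Proof. by rewrite /z /= pull_comp. Qed.

Let q_cvg1 (d : R) : 0 < d ->
  exists N, forall n, (N <= n)%N -> 1 - q n < d.
Proof.
move=> d0.
have Qdec : nonincreasing_seq Q.
  apply/nonincreasing_seqP => n; rewrite QS ler_piMr ?cabs_ge0//.
have Qlb : has_lbound (range Q) by exists c => _ [n _ <-]; exact: Qc.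
have := nonincreasing_cvgn Qdec Qlb.
set l := inf _ => Ql.
have : (fun n => Q n - Q n.+1) @ \oo --> l - l.
  by apply: cvgB => //; rewrite (cvg_shiftS Q).
rewrite subrr => /cvgrPdist_lt/(_ (d * c) (mulr_gt0 d0 c0))[N _ hN].
exists N => n /hN /=; rewrite sub0r normrN QS.
move=> /(le_lt_trans (ler_norm _)).
have := Qc n; rewrite -/(Q n); have := q_le1 n.
move: (Q n) (q n) => u v v1 cu h; rewrite -(ltr_pM2r c0).
have : (1 - v) * c <= (1 - v) * u by rewrite ler_wpM2l ?subr_ge0.
lra.
Qed.

(** The factors of a product that stays away from 0 tend to 1, so the orbit of
    x approaches the finite set of ends.  The dynamics then carries ends
    exactly to ends, and because it does not decrease the distance from the
    orbit to them, that distance is eventually 0. *)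
Lemma eventually_isometric :
  exists N, forall n, (N <= n)%N ->
    cabs (inv_den (T n) (cpt (pull (moeb_prod T n) x))) = 1.
Proof.
have b0 := moeb_b_neq0 Tx.
have [m m0 hm] := fin_gap (fun a : A => cabs_ge0 (moeb_b (F a))).
have bm n : m <= cabs (moeb_b (T n)).
  rewrite leNgt; apply: contra (b0 n) => /hm /eqP; by rewrite cabs_eq0.
have /choice[e he] : forall a, exists e : bool -> circle R,
    moeb_b (F a) != 0 -> forall y, cdist y (e false) * cdist y (e true) =
    `|1 - cabs (inv_den (F a) (cpt y)) ^+ 2| /
      (cabs (moeb_a (F a)) * cabs (moeb_b (F a))).
  move=> a; have [a0|/expansion_endpoints[e he]] := eqVneq (moeb_b (F a)) 0.
    by exists (fun=> point).
  by exists e.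
have qe a t : moeb_b (F a) != 0 -> cabs (inv_den (F a) (cpt (e a t))) = 1.
  move=> a0; have := he a a0 (e a t).
  have -> : cdist (e a t) (e a false) * cdist (e a t) (e a true) = 0.
    by case: t; rewrite cdistxx ?mulr0 ?mul0r.
  have A0 : cabs (moeb_a (F a)) * cabs (moeb_b (F a)) != 0.
    rewrite mulf_neq0 ?cabs_eq0// -cabs_eq0 gt_eqF//.
    exact: lt_le_trans ltr01 (cabs_a_ge1 _).
  move=> /esym/eqP; rewrite mulf_eq0 invr_eq0 (negbTE A0) orbF.
  rewrite normr_eq0 subr_eq0.
  by rewrite eq_sym sqrp_eq1 ?cabs_ge0// => /eqP.
pose tau n := cdist (z n) (e (w n) true) < cdist (z n) (e (w n) false).
(* E n is the end nearest to z n. *)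
pose E n := e (w n) (tau n).
have zE_min n : cdist (z n) (E n) =
    Num.min (cdist (z n) (e (w n) false)) (cdist (z n) (e (w n) true)).
  by rewrite /E /tau; case: ltP.
have zE (d : R) : 0 < d ->
    exists N, forall n, (N <= n)%N -> cdist (z n) (E n) < d.
  move=> d0.
  have d'0 : 0 < d ^+ 2 * m / 2 by rewrite divr_gt0// mulr_gt0// exprn_gt0.
  have [N hN] := q_cvg1 d'0; exists N => n /hN h.
  rewrite zE_min; apply: min_lt_of_mul_lt => //; try exact: cdist_ge0.
  rewrite he; last exact: b0.
  have a1 := cabs_a_ge1 (T n); have bn := bm n.
  have ab : m <= cabs (moeb_a (T n)) * cabs (moeb_b (T n)).
    move: a1 bn m0; move: (cabs (moeb_a _)) (cabs (moeb_b _)) => u v; nra.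
  rewrite ltr_pdivrMr; last exact: lt_le_trans ab.
  have := q_le1 n; have q0 : 0 <= q n := cabs_ge0 _.
  rewrite -/(T n) -/(q n) => q1.
  rewrite ger0_norm; last by rewrite subr_ge0 expr_le1.
  apply: lt_le_trans (_ : d ^+ 2 * m <= _); last by rewrite ler_wpM2l// sqr_ge0.
  move: h q1 q0; move: (d ^+ 2 * m) (q n) => u v; nra.
have [g g0 hg] := fin_gap (fun i : A * bool * (A * bool) =>
  cdist_ge0 (pull (F i.1.1) (e i.1.1 i.1.2)) (e i.2.1 i.2.2)).
have [N hN] : exists N, forall n, (N <= n)%N -> pull (T n) (E n) = E n.+1.
  have g2 : 0 <= g / 2 by rewrite divr_ge0// ltW.
  have d0 : 0 < g / 2 * Num.min c 1.
    by rewrite mulr_gt0 ?divr_gt0// lt_min c0 ltr01.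
  have [N hN] := zE _ d0; exists N => n Nn.
  apply: cdist_eq0; apply: (hg ((w n, tau n), (w n.+1, tau n.+1))) => /=.
  apply: le_lt_trans (cdistD (pull (T n) (z n)) _ _) _.
  rewrite -zS [ltRHS](splitr g) ltrD//; last first.
    apply: lt_le_trans (hN _ (leqW Nn)) _.
    by rewrite ler_piMr// ge_min lexx orbT.
  rewrite zS cdist_pull qe; last exact: b0.
  rewrite mul1r cdistC ltr_pdivrMr ?inv_den_gt0//.
  apply: lt_le_trans (hN _ Nn) _; rewrite ler_wpM2l//.
  by rewrite ge_min q_ge.
(* An orbit point that is not an end would stay at a positive distance from the
   ends. *)
exists N => n Nn.
suff zn : z n = E n by rewrite -/(z n) zn; exact: qe (b0 n).
have dS k : (N <= k)%N -> cdist (z k) (E k) <= cdist (z k.+1) (E k.+1).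
  move=> /hN <-; rewrite zS cdist_pull qe ?mulr1//; last exact: b0.
  rewrite ler_pdivlMr ?inv_den_gt0// ler_piMr ?cdist_ge0//; exact: q_le1.
have dmono k : cdist (z n) (E n) <= cdist (z (n + k)%N) (E (n + k)%N).
  elim: k => [|k /le_trans]; first by rewrite addn0.
  by apply; rewrite addnS dS// (leq_trans Nn)// leq_addr.
apply: cdist_eq0; apply/eqP; rewrite eq_le cdist_ge0 andbT leNgt.
apply/negP => /zE[M hM]; have := hM _ (leq_addl n M).
by rewrite ltNge dmono.
Qed.

End non_contracting.

(** Either the derivative of M_n^-1 at x is unbounded, or from some index on all
    letters have derivative 1 along the orbit and act as translations of one
    sign. *)
Lemma expanding_limit_escape x : expanding_limit T x ->
  forall K : R, exists N, forall n, (N <= n)%N ->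
    K <= cabs (moeb_a (moeb_prod T n)).
Proof.
move=> Tx K.
have [[c c0 Qc]|small] := pselect (exists2 c : R, 0 < c &
    forall n, c <= cabs (inv_den (moeb_prod T n) (cpt x))).
  have [N hN] := eventually_isometric Tx c0 Qc.
  have T'x := expanding_limit_drop N Tx.
  have q1 n : cabs (inv_den (T (N + n)%N) (cpt
      (pull (moeb_prod (fun i => T (N + i)%N) n)
        (pull (moeb_prod T N) x)))) = 1.
    by rewrite -pull_comp -moeb_prodD hN// leq_addr.
  have [m m0 hm] := fin_gap (fun a : A => cabs_ge0 (moeb_b (F a))).
  have bm n : m <= cabs (moeb_b (T (N + n)%N)).
    rewrite leNgt; apply: contra (moeb_b_neq0 Tx (N + n)%N) => /hm /eqP.
    by rewrite cabs_eq0.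
  have grow := parabolic_growth T'x q1 bm.
  set d := cabs (moeb_a (moeb_prod T N)) - cabs (moeb_b (moeb_prod T N)).
  have d0 : 0 < d by rewrite subr_gt0 cabs_b_lt_a.
  have dm0 : 0 < d * m by rewrite mulr_gt0.
  set k := Num.bound `|K / (d * m)|.
  exists (N + k)%N => n Nn.
  have kn : (k <= n - N)%N by rewrite leq_subRL// (leq_trans (leq_addr _ _) Nn).
  rewrite -(subnKC (leq_trans (leq_addr _ _) Nn)) moeb_prodD.
  apply: le_trans (cabs_a_comp _ _); rewrite -/d.
  apply: le_trans (_ : d * ((n - N)%:R * m) <= _); last first.
    by rewrite ler_wpM2l ?grow// ltW.
  rewrite mulrCA -ler_pdivrMr// (le_trans (ler_norm _))//.
  by rewrite ltW// (lt_le_trans (archi_boundP (normr_ge0 _)))// ler_nat.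
pose K' := `|K| + 1; have K'0 : 0 < K' by rewrite ltr_wpDl.
have [N QN] : exists N, cabs (inv_den (moeb_prod T N) (cpt x)) < (2 * K')^-1.
  apply: contrapT => h; apply: small; exists (2 * K')^-1.
    by rewrite invr_gt0 mulr_gt0.
  by move=> n; rewrite leNgt; apply/negP => hn; apply: h; exists n.
exists N => n Nn.
have Qn : cabs (inv_den (moeb_prod T n) (cpt x)) < (2 * K')^-1.
  apply: le_lt_trans QN; rewrite -(subnKC Nn); elim: (n - N)%N => [|k IH].
    by rewrite addn0.
  apply: le_trans IH; rewrite addnS inv_den_prod ler_piMr ?cabs_ge0//.
  exact: expanding_limit_le1.
apply: le_trans (_ : K' <= _).
  by rewrite /K' (le_trans (ler_norm _))// lerDl.
exact: inv_den_small Qn.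
Qed.

End escape_to_boundary.

(** * Arc length and weak convergence to a Dirac measure *)

Section circle_measure.
Context (R : realType).
Implicit Types (x y : circle R) (B : set (circle R)).

Lemma circle_open_measurable B : open B -> measurable B.
Proof. by move=> oB; exact: sub_sigma_algebra. Qed.

Lemma continuous_measurable_circle (g : circle R -> circle R) :
  continuous g -> measurable_fun setT g.
Proof.
move=> /continuousP cg.
apply: (@measurability _ _ _ _ _ _ (@open (circle R))) => // _ [B oB <-].
by rewrite setTI; apply: circle_open_measurable; exact: cg.
Qed.

Lemma continuous_measurable_real (f : circle R -> R) :
  continuous f -> measurable_fun setT f.
Proof.
move=> /continuousP cf.
apply: (measurability _ (RGenOpens.measurableE R)) => _ [_ [a [b ->]] <-].
rewrite setTI; apply: circle_open_measurable; apply: cf.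
exact: interval_open.
Qed.

Lemma measurable_far (g : circle R -> circle R) x (r : R) :
  continuous g -> measurable [set y | r <= cdist (g y) x].
Proof.
move=> /continuousP cg.
have -> : [set y | r <= cdist (g y) x] = ~` (g @^-1` [set y | cdist y x < r]).
  by apply/seteqP; split => y /=; rewrite leNgt => /negP.
apply: measurableC; apply: circle_open_measurable; apply: cg.
rewrite openE => y /= yx; apply/nbhs_cdistP; exists (r - cdist y x).
  by rewrite subr_gt0.
move=> z yz; rewrite /= (le_lt_trans (cdistD y _ _))// cdistC.
by rewrite -ltrBrDr.
Qed.

Lemma cdist_cis (s t : R) :
  cdist (cis s) (cis t) ^+ 2 = 2 - 2 * cos (s - t).
Proof.
rewrite /cdist /cpt /= /cabs /= sqr_sqrtr ?addr_ge0 ?sqr_ge0// cosB.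
have := cos2Dsin2 s; have := cos2Dsin2 t.
move: (cos s) (sin s) (cos t) (sin t) => a b c d; nra.
Qed.

(** Chord length is increasing in arc length up to a half turn, and symmetric
    about it. *)
Lemma cos_2pi_le (d u : R) : 0 <= d <= 2^-1 -> d <= u <= 1 - d ->
  cos (2 * pi * u) <= cos (2 * pi * d).
Proof.
move=> /andP[d0 d2]; wlog u2 : u / u <= 2^-1 => [H|] /andP[du ud].
  have [u2|u2] := leP u 2^-1; first by apply: H => //; rewrite du.
  have -> : 2 * pi * u = - (2 * pi * (1 - u)) + pi *+ 2 by rewrite mulr2n; ring.
  rewrite cosD2pi cosN; apply: H; lra.
have p0 := pi_gt0 R.
have inpi (v : R) : 0 <= v -> v <= 2^-1 -> 2 * pi * v \in `[0 : R, pi].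
    move=> v0 v2; rewrite in_itv /= !mulr_ge0 ?pi_ge0//=.
  by rewrite mulrAC -[leRHS]mul1r ler_pM2r//; lra.
rewrite leNgt; apply/negP.
rewrite ltr_cos ?inpi ?(le_trans d0 du)//.
by move: du p0; move: (@pi R) => p; nra.
Qed.

(** Points with a chord shorter than that of the arc 2 pi d have parameters in
    [0, 1] at distance less than d modulo 1, so that three intervals of length
    2 d around one of these parameters and its translates by 1 cover them all. *)
Lemma circle_unif_small_diam B (d : R) : measurable B -> 0 < d <= 2^-1 ->
  (forall x y, B x -> B y -> cdist x y ^+ 2 < 2 - 2 * cos (2 * pi * d)) ->
  (circle_unif R B <= (6 * d)%:E)%E.
Proof.
move=> mB /andP[d0 d2] hB.
pose C := @cis2pi R @^-1` B `&` `[0, 1].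
have mC : measurable C.
  apply: measurableI => //; rewrite -[X in measurable X]setTI.
  exact: measurable_cis2pi.
have -> : circle_unif R B = lebesgue_measure C.
  rewrite [LHS]/(uniform_prob _ (_ @^-1` B)) /uniform_prob integral_uniform_pdf.
  rewrite (eq_integral (fun=> 1%E)); last first.
    move=> t; rewrite inE => -[_]; rewrite /= in_itv /= /uniform_pdf => ->.
    by rewrite subr0 invr1.
  by rewrite integral_cst// mul1e.
have [->|/set0P[s [Bs s01]]] := eqVneq C set0.
  by rewrite measure0 lee_fin mulr_ge0// ltW.
pose I (c : R) : set (measurableTypeR R) := `]c - d, c + d[%classic.
have mI c : measurable (I c) by exact: measurable_itv.
have muI c : lebesgue_measure (I c) = (2 * d)%:E.
  rewrite /I lebesgue_measure_itv /= lte_fin ltrD2l gtrN// -EFinB.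
  by congr EFin; ring.
have CI : C `<=` I s `|` (I (s - 1) `|` I (s + 1)).
  move=> t [Bt]; move: s01; rewrite /I /= !in_itv /=.
  move=> /andP[s0 s1] /andP[t0 t1].
  have := hB _ _ Bs Bt; rewrite cdist_cis -mulrBr ltrD2l ltrN2.
  rewrite ltr_pM2l// => hcos.
  have nu u : cos (2 * pi * u) = cos (2 * pi * (s - t)) -> ~ (d <= u <= 1 - d).
    move=> e /cos_2pi_le; rewrite e (ltW d0) d2 => /(_ isT).
    by rewrite leNgt hcos.
  have n1 := nu _ erefl.
  have n2 : ~ (d <= t - s <= 1 - d).
    by apply: nu; rewrite -cosN; congr cos; ring.
  have [ts|ts] := leP t s.
    have [h|h] := ltP (s - t) d; first by left; lra.
    right; left; have [h'|h'] := leP (s - t) (1 - d); last by lra.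
    by case: n1; rewrite h.
  have [h|h] := ltP (t - s) d; first by left; lra.
  right; right; have [h'|h'] := leP (t - s) (1 - d); last by lra.
  by case: n2; rewrite h.
apply: (@le_trans _ _ (lebesgue_measure (I s `|` (I (s - 1) `|` I (s + 1))))).
  by apply: le_measure; rewrite ?inE//; do 2 ?[apply: measurableU].
apply: (@le_trans _ _ (lebesgue_measure (I s) +
    (lebesgue_measure (I (s - 1)%R) + lebesgue_measure (I (s + 1)%R)))%E).
  apply: le_trans (measureU2 _ _ _) _; [exact: mI|exact: measurableU|].
  by rewrite leeD2l//; exact: measureU2.
by rewrite !muI -!EFinD lee_fin; lra.
Qed.

(** Convergence in probability to a constant implies weak convergence to the
    Dirac measure.  Pointwise convergence may fail almost everywhere, so
    that the integral is split over a small set and its complement instead of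
    using dominated convergence. *)
Lemma represents_of_cvg_measure (G : nat -> circle R -> circle R) x :
  (forall n, continuous (G n)) ->
  (forall e d : R, 0 < e -> 0 < d -> exists N, forall n, (N <= n)%N ->
     (circle_unif R [set y | e <= cdist (G n y) x]%R <= d%:E)%E) ->
  represents G x.
Proof.
move=> cG hG f cf.
have mf := continuous_measurable_real cf.
have mG n := continuous_measurable_circle (cG n).
rewrite integral_dirac//; last exact/measurable_EFinP.
rewrite diracT mul1e.
have [M0 hM] : exists M : R, forall y, `|f y| <= M.
  have /compact_bounded [M [_ hM]] : compact (f @` setT).
    apply: continuous_compact; last exact: circle_compact.
    exact: continuous_subspaceT.
  exists (M + 1) => y; apply: (hM (M + 1)); first by rewrite ltrDl.
  by exists y.
pose M := M0 + 1.
have M_gt0 : 0 < M by rewrite ltr_wpDl// (le_trans _ (hM point)).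
have fM y : `|f y| <= M by rewrite (le_trans (hM y))// lerDl.
have PT : circle_unif R setT = 1%E := probability_setT _.
have PTy : (circle_unif R setT < +oo)%E by rewrite PT ltry.
have cstE (k : R) : Rintegral (circle_unif R) setT (cst k) = k.
  rewrite [LHS](Rintegral_cst _ measurableT) -[RHS]mulr1; congr (_ * _).
  exact: (congr1 fine PT).
have bounded_int (g : circle R -> R) : measurable_fun setT g ->
    (exists K : R, forall y, `|g y| <= K) ->
    (circle_unif R).-integrable setT (EFin \o g).
  move=> mg [K hK]; apply: measurable_bounded_integrable => //.
  exists K; split; first exact: num_real.
  by move=> L KL y _; apply: le_trans (hK y) (ltW KL).
have mfG m : measurable_fun setT (f \o G m) by exact: measurableT_comp.
have fG_int n : (circle_unif R).-integrable setT (EFin \o (f \o G n)).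
  apply: bounded_int; first exact: measurableT_comp.
  by exists M => y; exact: fM.
have -> : (fun n => \int[pushforward (circle_unif R) (G n)]_y (f y)%:E)%E =
    (fun n => (Rintegral (circle_unif R) setT (f \o G n))%:E).
  have mEf : measurable_fun setT (EFin \o f) by exact/measurable_EFinP.
  apply/funext => n.
  rewrite (integral_pushforward (mG n) mEf (fG_int n) measurableT).
  by rewrite preimage_setT /Rintegral fineK// (integrable_fin_num _ (fG_int n)).
apply: cvg_EFin; first exact: nearW.
apply/cvgrPdist_le => e e0.
have e2 : 0 < e / 2 by rewrite divr_gt0.
have /nbhs_cdistP[r r0 hr] := cf x _ (nbhsx_ballx (f x) (e / 2) e2).
have eM : 0 < e / 2 / (2 * M) by rewrite divr_gt0// mulr_gt0.
have [N hN] := hG r _ r0 eM.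
exists N => // n /= /hN {}hN.
pose B := [set y | r <= cdist (G n y) x].
have mB : measurable B by exact: measurable_far.
have cst_int (k : R) : (circle_unif R).-integrable setT (EFin \o cst k).
  by apply: bounded_int => //; exists `|k|.
have B_int : (circle_unif R).-integrable setT (EFin \o \1_B).
  apply: bounded_int => //.
  by exists 1 => y; rewrite indicE; case: (_ \in _); rewrite /= ?normr1 ?normr0.
have B2_int : (circle_unif R).-integrable setT
    (EFin \o (fun y => 2 * M * \1_B y)).
  apply: bounded_int; first exact: measurable_funM.
  exists (2 * M) => y; rewrite indicE.
  have M2 : 0 < 2 * M by rewrite mulr_gt0.
  by case: (_ \in _); rewrite /= ?mulr1 ?mulr0 ?normr0 ?gtr0_norm// ltW.
have mfGx : measurable_fun setT (fun y => cst (f x) y - (f \o G n) y).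
  exact: measurable_funB.
have -> : f x = Rintegral (circle_unif R) setT (cst (f x)).
  by rewrite cstE.
rewrite -(RintegralB measurableT (cst_int (f x)) (fG_int n)).
apply: le_trans (le_normr_Rintegral _ _) _ => //.
  apply: bounded_int => //.
  exists (M + M) => y; rewrite (le_trans (ler_normB _ _))// lerD//; exact: fM.
apply: (@le_trans _ _ (Rintegral (circle_unif R) setT
    (fun y => e / 2 + 2 * M * \1_B y))).
  apply: le_Rintegral => //.
  - apply: bounded_int; first exact: measurableT_comp.
    exists (M + M) => y.
    by rewrite normr_id (le_trans (ler_normB _ _))// lerD//; exact: fM.
  - by apply: (@integrableD _ _ _ (circle_unif R) setT _
      (EFin \o cst (e / 2)) (EFin \o (fun y => 2 * M * \1_B y))).
  move=> y _ /=; rewrite indicE; have [By|nBy] := boolP (y \in B).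
    rewrite mulr1 (le_trans (ler_normB _ _))//.
    by have := fM x; have := fM (G n y); lra.
  rewrite mulr0 addr0 ltW//; apply: hr; rewrite cdistC ltNge.
  by apply: contra nBy => h; rewrite inE.
rewrite (RintegralD measurableT (cst_int (e / 2)) B2_int) cstE.
rewrite (RintegralZl _ measurableT B_int).
have -> : Rintegral (circle_unif R) setT \1_B = fine (circle_unif R B).
  by rewrite /Rintegral integral_indic// setIT.
rewrite [leRHS](splitr e) lerD2l mulrC -ler_pdivlMr ?mulr_gt0//.
by rewrite -lee_fin fineK// fin_num_measure.
Qed.

(** b / a^* is F(0). *)
Lemma moebius_sub_center (F : disc_moebius R) y :
  cpt (moebius_circle F y) - moeb_b F / (moeb_a F)^* =
  cpt y / ((moeb_a F)^* * ((moeb_b F)^* * cpt y + (moeb_a F)^*)).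
Proof.
have y1 : `|sval y| = 1 by have := valP y; rewrite inE.
have d0 := moebius_den_neq0 F y1.
have a0 : (moeb_a F)^* != 0.
  by rewrite fmorph_eq0 -cabs_gt0 (lt_le_trans ltr01)// cabs_a_ge1.
rewrite /cpt /= /moebius -[X in _ = X / _]mul1r -(moeb_det F).
move: d0 a0; rewrite -[val y]/(sval y).
move: (moeb_a F) (moeb_b F) => a b; move: a^* b^* (sval y) => a' b' z d0 a0.
by field; rewrite ?a0 ?d0.
Qed.

Lemma center_sub (F : disc_moebius R) x :
  cpt x - moeb_b F / (moeb_a F)^* =
  cpt x * (inv_den F (cpt x))^* / (moeb_a F)^*.
Proof.
have a0 : (moeb_a F)^* != 0.
  by rewrite fmorph_eq0 -cabs_gt0 (lt_le_trans ltr01)// cabs_a_ge1.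
rewrite /inv_den rmorphB rmorphM /= conjCK conj_cpt.
by have x0 := cpt_neq0 x; field; rewrite ?a0 ?x0.
Qed.

(** Points that F sends far from x are close to the pole, where the denominator
    b^* y + a^* of F is at most 2 / (e |a|), hence close to each other.
    Comparing two of them avoids locating the pole. *)
Lemma moebius_far_close (F : disc_moebius R) x y1 y2 (e : R) : 0 < e ->
  cabs (inv_den F (cpt x)) <= 1 -> 2 <= cabs (moeb_a F) * e ->
  2 <= cabs (moeb_a F) ->
  e <= cdist (moebius_circle F y1) x -> e <= cdist (moebius_circle F y2) x ->
  cdist y1 y2 <= 4 / (e * cabs (moeb_a F)).
Proof.
move=> e0 q1 ae a2 e1 e2.
have A0 : 0 < cabs (moeb_a F) by rewrite (lt_le_trans ltr01)// cabs_a_ge1.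
set den := fun y : circle R => (moeb_b F)^* * cpt y + (moeb_a F)^*.
have far y : e <= cdist (moebius_circle F y) x ->
    cabs (den y) <= 2 / (e * cabs (moeb_a F)).
  move=> ey; set c := moeb_b F / (moeb_a F)^*.
  have d0 : 0 < cabs (den y).
    have y1' : `|sval y| = 1 by have := valP y; rewrite inE.
    by rewrite cabs_gt0; exact: moebius_den_neq0.
  have xc : cabs (c - cpt x) <= (cabs (moeb_a F))^-1.
    rewrite cabsB center_sub !cabsM cabs_cpt mul1r cabsV !cabsJ.
    by rewrite ler_piMl// invr_ge0 ltW.
  have yc : cabs (cpt (moebius_circle F y) - c) =
      (cabs (moeb_a F) * cabs (den y))^-1.
    by rewrite moebius_sub_center cabsM cabs_cpt mul1r cabsV cabsM cabsJ.
  have := cabs_distD (cpt (moebius_circle F y)) c (cpt x).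
  rewrite -/(cdist _ _) yc => /(le_trans ey) /le_trans /(_ (lerD (lexx _) xc)).
  have ha : (cabs (moeb_a F))^-1 <= e / 2.
    by rewrite -[leLHS]mul1r ler_pdivrMr//; lra.
  move=> h; have {h ha} : e / 2 <= (cabs (moeb_a F) * cabs (den y))^-1 by lra.
  rewrite -[leRHS]mul1r ler_pdivlMr ?mulr_gt0// => h.
  by rewrite ler_pdivlMr ?mulr_gt0//; nra.
have b1 : 1 <= cabs (moeb_b F).
  have := moeb_disc_cabs F; have := cabs_ge0 (moeb_b F).
  by move: a2; move: (cabs (moeb_a F)) (cabs (moeb_b F)) => a b; nra.
have : cabs (moeb_b F) * cdist y1 y2 <= 4 / (e * cabs (moeb_a F)).
  rewrite -cabsJ /cdist -cabsM.
  have -> : (moeb_b F)^* * (cpt y1 - cpt y2) = den y1 - den y2.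
    by rewrite /den; ring.
  apply: le_trans (cabsD _ _) _; rewrite cabsN.
  by have := far _ e1; have := far _ e2; lra.
by apply: le_trans; rewrite ler_peMl ?cdist_ge0.
Qed.

Lemma escape_represents (M : nat -> disc_moebius R) x :
  (forall n, cabs (inv_den (M n) (cpt x)) <= 1) ->
  (forall K : R, exists N, forall n, (N <= n)%N -> K <= cabs (moeb_a (M n))) ->
  represents (fun n => moebius_circle (M n)) x.
Proof.
move=> q1 hM.
have cM n : continuous (moebius_circle (M n)).
  have -> : moebius_circle (M n) = pull (moebius_inv (M n)).
    apply/funext => y; apply: (can_inj (moebiusK (moebius_inv (M n)))).
    by rewrite pullK; exact: moebiusK.
  exact: continuous_pull.
apply: represents_of_cvg_measure => // e d e0 d0.
(* Measure at most 6 d' <= d is wanted, and c is the square of the chord of the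
   arc 2 pi d'. *)
pose d' := Num.min (d / 6) 2^-1.
have d'0 : 0 < d' by rewrite lt_min divr_gt0//= invr_gt0.
have d'2 : d' <= 2^-1 by rewrite ge_min lexx orbT.
pose c := 2 - 2 * cos (2 * pi * d').
have c0 : 0 < c.
  rewrite subr_gt0 gtr_pMr// -[X in _ < X](cos0 R) ltr_cos; last 2 first.
  - by rewrite in_itv /= lexx pi_ge0.
  - rewrite in_itv /= !mulr_ge0 ?pi_ge0 ?(ltW d'0)//=.
    by rewrite mulrAC -[leRHS]mul1r ler_pM2r ?pi_gt0//; lra.
  by rewrite !mulr_gt0// pi_gt0.
pose r := Num.min c 1.
have r0 : 0 < r by rewrite lt_min c0 ltr01.
have [N hN] := hM (Num.max 2 (Num.max (2 / e) (8 / (e * r)))).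
exists N => n /hN; rewrite !ge_max => /and3P[a2 a2e a8].
apply: (@le_trans _ _ (6 * d')%:E); last first.
  by rewrite lee_fin mulrC -ler_pdivlMr// ge_min lexx.
apply: circle_unif_small_diam; [exact: measurable_far|by rewrite d'0|].
move=> y1 y2 h1 h2; rewrite -/c.
have a2e' : 2 <= cabs (moeb_a (M n)) * e by rewrite -ler_pdivrMr.
have y12 : cdist y1 y2 <= r / 2.
  apply: le_trans (moebius_far_close e0 (q1 n) a2e' a2 h1 h2) _.
  move: a8; rewrite ler_pdivrMr ?mulr_gt0// => a8.
  rewrite ler_pdivrMr; first by lra.
  by rewrite mulr_gt0// (lt_le_trans _ a2).
have rc : r <= c by rewrite ge_min lexx.
have r1 : r <= 1 by rewrite ge_min lexx orbT.
apply: lt_le_trans rc; have := cdist_ge0 y1 y2.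
by move: r0 r1 y12; move: (r) (cdist y1 y2) => u v; nra.
Qed.

End circle_measure.

(** * Prefixes and the topology of infinite words *)

Section words.
Context (A : finType).
Implicit Types (w : omega_words A) (v : seq A) (Sigma : set (omega_words A)).

Lemma word_prefixP w w' n :
  word_prefix w n = word_prefix w' n <-> forall i, (i < n)%N -> w i = w' i.
Proof.
split=> [e i i_n|e].
  have := congr1 (fun s => nth (w i) s i) e.
  by rewrite /word_prefix /subword !nth_mkseq.
by apply/eq_in_map => i; rewrite mem_iota => /andP[_ ?]; exact: e.
Qed.

Lemma size_word_prefix w n : size (word_prefix w n) = n.
Proof. exact: size_mkseq. Qed.

Lemma word_prefixS w n : word_prefix w n.+1 = rcons (word_prefix w n) (w n).
Proof. by rewrite /word_prefix /subword mkseqS. Qed.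

Lemma cylinder_prefix w w' n : cylinder (word_prefix w n) w' <->
  forall i, (i < n)%N -> w' i = w i.
Proof. by rewrite /cylinder /= size_word_prefix word_prefixP. Qed.

Lemma nbhs_cylinder w n : nbhs w (cylinder (word_prefix w n)).
Proof.
elim: n => [|n IH].
  by apply: filterS filterT => w' _; apply/cylinder_prefix.
have nw : nbhs w [set w' : omega_words A | w' n = w n].
  exact: (@proj_continuous _ (fun _ : nat => discrete_topology A) n w
    [set w n] (discrete_set1 (w n : discrete_topology A))).
apply: filterS (filterI IH nw) => w' [/cylinder_prefix h /= e].
by apply/cylinder_prefix => i; rewrite ltnS leq_eqVlt => /predU1P[->//|/h].
Qed.

Lemma nbhs_sub_cylinder w U : nbhs w U ->
  exists n, cylinder (word_prefix w n) `<=` U.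
Proof.
pose G : set_system (omega_words A) :=
  fun U => exists n, cylinder (word_prefix w n) `<=` U.
have FG : Filter G.
  split; first by exists 0%N.
  - move=> P Q [m mP] [n nQ]; exists (maxn m n) => w' /cylinder_prefix h.
    split; [apply: mP|apply: nQ]; apply/cylinder_prefix => i hi; apply: h.
      by rewrite leq_max hi.
    by rewrite leq_max hi orbT.
  - by move=> P Q PQ [n nP]; exists n; exact: subset_trans PQ.
suff : G --> w by apply.
apply/cvg_sup => i V [_ [[B oB <-] /= Bw BV]].
exists i.+1 => w' /cylinder_prefix h.
by apply: BV; rewrite /= /proj h.
Qed.

Lemma iter_shift w m i : iter m (@one_sided_shift A) w i = w (m + i)%N.
Proof.
elim: m w => // m IH w; rewrite iterSr IH /one_sided_shift addSn.
by congr w; rewrite addSn.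
Qed.

(** A factor at position m is a prefix of the m-th shift. *)
Lemma language_prefix Sigma v : subshift Sigma -> language Sigma v ->
  exists2 w, Sigma w & cylinder v w.
Proof.
move=> [_ sS] [w [m [Sw wv]]]; exists (iter m (@one_sided_shift A) w).
  elim: m {wv} => //= m IH; apply: sS.
  by exists (iter m (@one_sided_shift A) w).
rewrite /cylinder /= -[RHS]wv; apply/eq_in_map => i _.
exact: iter_shift.
Qed.

Lemma prefix_language Sigma w n : Sigma w -> language Sigma (word_prefix w n).
Proof. by move=> Sw; exists w, 0%N; rewrite size_word_prefix. Qed.

Lemma closed_language Sigma w : subshift Sigma ->
  (forall n, exists2 m, (n <= m)%N & language Sigma (word_prefix w m)) ->
  Sigma w.
Proof.
move=> SS hw; apply: SS.1 => U /nbhs_sub_cylinder[n nU].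
have [m nm /(language_prefix SS)[w' Sw' /cylinder_prefix h]] := hw n.
exists w'; split => //; apply: nU; apply/cylinder_prefix => i i_n.
by apply: h; exact: leq_trans nm.
Qed.

(** Iterates the extension by one letter: u n is the word after n steps, and w
    reads its i-th letter from u i.+1, which is already longer than i. *)
Lemma word_limit (P : seq A -> Prop) v : P v ->
  (forall u, P u -> exists a, P (rcons u a)) ->
  exists w, cylinder v w /\ forall n, P (word_prefix w (size v + n)).
Proof.
move=> Pv hP; have [a0 _] := hP v Pv.
have /choice[step hstep] : forall u, exists a, P u -> P (rcons u a).
  move=> u; have [/hP[a Pa]|nP] := pselect (P u); first by exists a.
  by exists a0.
pose u n := iter n (fun s => rcons s (step s)) v.
have Pu n : P (u n) by elim: n => //= n IH; exact: hstep.
have su n : size (u n) = (size v + n)%N.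
  by elim: n => [|n IH]; rewrite ?addn0//= size_rcons IH addnS.
have nthu n k i : (i < size v + n)%N -> nth a0 (u (n + k)%N) i = nth a0 (u n) i.
  move=> hi; elim: k => [|k IH]; first by rewrite addn0.
  by rewrite addnS /= nth_rcons su (leq_trans hi) ?IH// leq_add2l leq_addr.
pose w : omega_words A := fun i => nth a0 (u i.+1) i.
have wu n : word_prefix w (size v + n) = u n.
  apply: (@eq_from_nth _ a0); first by rewrite size_word_prefix su.
  move=> i; rewrite size_word_prefix => hi.
  rewrite nth_mkseq// add0n /w -(nthu n i.+1)// addnC nthu//.
  by rewrite addnS ltnS leq_addl.
exists w; split; last by move=> n; rewrite wu.
by have := wu 0%N; rewrite addn0.
Qed.

End words.

(** * Interval shifts *)

Section interval_systems.
Context (R : realType) (A : finType).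
Variables (F : A -> disc_moebius R) (W : A -> set (circle R)).
Hypothesis WV : forall a, W a `<=` expansion_interval (F a).
Implicit Types (w : omega_words A) (v : seq A) (x y : circle R).

Definition letter_maps w (n : nat) : disc_moebius R := F (w n).

Lemma word_map_prefix w n : word_map F (word_prefix w n) =
  moebius_circle (moeb_prod (letter_maps w) n).
Proof.
have word_map_rcons v a : word_map F (rcons v a) =
    word_map F v \o moebius_circle (F a).
  by elim: v => [|b v IH] //=; rewrite IH.
elim: n => [|n IH]; first by rewrite moebius_id.
by rewrite word_prefixS word_map_rcons IH /= moebius_comp.
Qed.

(** Replaces images under products of letter maps by conditions on the orbit of
    y under the inverse maps, which the expansion hypothesis is about. *)
Lemma refined_prefixP w n y : refined F W (word_prefix w n) y <->
  forall i, (i < n)%N -> W (w i) (pull (moeb_prod (letter_maps w) i) y).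
Proof.
set u := word_prefix w n.
have su : size u = n := size_word_prefix w n.
have tu i : (i <= n)%N -> take i u = word_prefix w i.
  move=> i_n; apply: (@eq_from_nth _ (w 0%N)).
    by rewrite size_takel ?su// size_word_prefix.
  move=> j; rewrite size_takel ?su// => ji.
  by rewrite nth_take// !nth_mkseq// (leq_trans ji).
have nu (i : 'I_(size u)) : tnth (in_tuple u) i = w i.
  by rewrite (tnth_nth (w 0%N)) /= nth_mkseq// -su.
split=> h i.
  move=> i_n; have i_u : (i < size u)%N by rewrite su.
  have [z Wz <-] := h (Ordinal i_u) I.
  by move: Wz; rewrite nu /= tu ?word_map_prefix ?moebiusK// ltnW.
move=> _; have i_n : (i < n)%N by rewrite -[X in (_ < X)%N]su.
exists (pull (moeb_prod (letter_maps w) i) y).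
  by rewrite nu; exact: h.
by rewrite tu ?word_map_prefix ?pullK// ltnW.
Qed.

Lemma refined_prefix_decr w m n : (m <= n)%N ->
  refined F W (word_prefix w n) `<=` refined F W (word_prefix w m).
Proof.
move=> mn y /refined_prefixP h; apply/refined_prefixP => i im.
by apply: h; exact: leq_trans mn.
Qed.

Lemma refined_expanding_limit w x :
  (forall n, closure (refined F W (word_prefix w n)) x) ->
  expanding_limit (letter_maps w) x.
Proof.
move=> hx n e e0.
have /closure_cdistP/(_ _ e0)[y /refined_prefixP hy xy] := hx n.
by exists y => // i /hy /WV /expansion_interval_lt1.
Qed.

Lemma refined_represents w x :
  (forall n, closure (refined F W (word_prefix w n)) x) ->
  represents (fun n => word_map F (word_prefix w n)) x.
Proof.
move=> /refined_expanding_limit wx.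
have -> : (fun n => word_map F (word_prefix w n)) =
    (fun n => moebius_circle (moeb_prod (letter_maps w) n)).
  by apply/funext => n; exact: word_map_prefix.
apply: escape_represents; last exact: expanding_limit_escape wx.
elim=> [|n IH]; first by rewrite inv_den_id cabs1.
by rewrite inv_den_prod mulr_ile1 ?cabs_ge0//; exact: expanding_limit_le1.
Qed.

(** Tested on the distance to x, a continuous function with x as its only
    zero. *)
Lemma represents_unique (G : nat -> circle R -> circle R) x y :
  represents G x -> represents G y -> x = y.
Proof.
move=> Gx Gy; pose f := cdist x : circle R -> R.
have cf : continuous f.
  move=> z U /nbhs_ballP[e e0 eU]; apply/nbhs_cdistP; exists e => // t zt.
  apply: eU; rewrite -ball_normE /= /f ltr_norml; apply/andP; split.
    by have := cdistD z x t; lra.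
  by have := cdistD t x z; rewrite (cdistC t z); lra.
have mf : measurable_fun setT (EFin \o f).
  by apply/measurable_EFinP; exact: continuous_measurable_real.
have := cvg_unique (@ereal_hausdorff R) (Gx f cf) (Gy f cf).
rewrite !integral_dirac// !diracT !mul1e => /(_ _)[].
by rewrite /f cdistxx => /esym/cdist_eq0.
Qed.

Lemma Phi_refined w x :
  (forall n, closure (refined F W (word_prefix w n)) x) -> Phi F w = x.
Proof.
move=> /refined_represents wx; apply: xget_subset1 => // y z /= wy wz.
exact: represents_unique wy wz.
Qed.

Lemma interval_shift_closure (Sigma : set (omega_words A)) w :
  interval_shift F W Sigma w ->
  forall n, closure (refined F W (word_prefix w n)) (Phi F w).
Proof.
move=> [_ ne]; have [|x hx] :=
  decreasing_closure_nonempty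
    (S := fun n => refined F W (word_prefix w n)) _ ne.
  exact: refined_prefix_decr.
by rewrite (Phi_refined hx).
Qed.

(** Nonemptiness of each refined set depends on a prefix only, hence is a closed
    condition; F^-1 of the first letter maps the refined set of a prefix into
    that of the shifted prefix. *)
Lemma subshift_interval_shift (Sigma : set (omega_words A)) :
  subshift Sigma -> subshift (interval_shift F W Sigma).
Proof.
move=> [cS sS]; split.
  move=> w cw; split.
    by apply: cS => U /cw[w' [[Sw' _] Uw']]; exists w'.
  move=> n; have [w' [[_ hw'] ww']] := cw _ (nbhs_cylinder w n).
  by have := hw' n; move: ww'; rewrite /cylinder /= size_word_prefix => ->.
move=> _ [w [Sw hw] <-]; split; first by apply: sS; exists w.
move=> n; have [y /refined_prefixP hy] := hw n.+1.
exists (pull (F (w 0%N)) y); apply/refined_prefixP => i i_n.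
have := hy i.+1 i_n; rewrite -(add1n i) moeb_prodD pull_comp /=.
by rewrite pull_comp pull_id.
Qed.

(** All words that share a long prefix with w have their value in the closure of
    one small refined set. *)
Lemma interval_shift_continuous (Sigma : set (omega_words A)) :
  {within interval_shift F W Sigma, continuous (Phi F)}.
Proof.
apply/subspace_continuousP => w Sw U nU.
have [n nU'] : exists n, closure (refined F W (word_prefix w n)) `<=` U.
  apply: (nested_closure_sub (x := Phi F w)) => //.
    exact: refined_prefix_decr.
  by move=> y /Phi_refined.
rewrite /= /within /=; apply: filterS (nbhs_cylinder w n) => w' ww' Sw'.
apply: nU'; have := interval_shift_closure Sw' n.
by move: ww'; rewrite /cylinder /= size_word_prefix => ->.
Qed.

(** Compatibility lets a point of the closure of W_v be followed along an
    infinite word, whose refined sets all have it in their closure. *)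
Lemma Phi_cylinder (Sigma : set (omega_words A)) v :
  subshift Sigma -> compatible F W Sigma -> language Sigma v ->
  Phi F @` (cylinder v `&` interval_shift F W Sigma) = closure (refined F W v).
Proof.
move=> SS [_ comp] Lv; apply/seteqP; split.
  move=> _ [w [vw Sw] <-]; have := interval_shift_closure Sw (size v).
  by rewrite vw.
move=> x vx.
have [||w [vw hw]] := @word_limit A
    (fun u => language Sigma u /\ closure (refined F W u) x) v => //.
  move=> u [Lu]; rewrite (comp u Lu) => -[a La ax]; by exists a.
have hx n : closure (refined F W (word_prefix w n)) x.
  by apply: closureS (hw n).2; apply: refined_prefix_decr; exact: leq_addl.
exists w; last exact: Phi_refined.
split => //; split.
  apply: closed_language => // n; exists (size v + n)%N; first exact: leq_addl.
  by have [] := hw n.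
by move=> n; have [y [Ry _]] := hx n _ filterT; exists y.
Qed.

End interval_systems.

Theorem theorem20 (R : realType) (A : finType) (F : A -> disc_moebius R)
    (W : A -> set (circle R)) (Sigma : set (omega_words A)) :
  interval_almost_cover W ->
  (forall a, W a `<=` expansion_interval (F a)) ->
  subshift Sigma ->
  compatible F W Sigma ->
  moebius_number_system F (interval_shift F W Sigma) /\
  (forall v : seq A, language Sigma v \/ refined F W v = set0 ->
     Phi F @` (cylinder v `&` interval_shift F W Sigma) =
     closure (refined F W v)).
Proof.
move=> _ WV SS comp; split; last first.
  move=> v [Lv|v0]; first exact: Phi_cylinder.
  rewrite v0 closure0; apply/seteqP; split=> // x [w [vw [_ hw]] _].
  by have := hw (size v); rewrite vw v0 => -[].
split.
- exact: subshift_interval_shift.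
- move=> w Sw; exists (Phi F w); apply: (refined_represents WV).
  exact: interval_shift_closure Sw.
- have [[w Sw] _] := comp.
  apply/seteqP; split => // x _.
  have : closure (refined F W (word_prefix w 0)) x.
    by apply: subset_closure; apply/(refined_prefixP F W).
  rewrite -(Phi_cylinder WV SS comp (prefix_language 0 Sw)).
  by move=> [w' [_ Sw'] <-]; exists w'.
- exact: interval_shift_continuous.
Qed.
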